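(* Let $k\ge1$ and $n>k$ be integers, and set $a=n-k$ and $b=k(n-k)-1$. Then $$\operatorname{vol}\mathcal F_{\mathrm{Car}^{(k)}_{n+1}}(1,\ldots,1,-n)=\mathrm{Cat}(a,b)\cdot k^{b-1}\cdot n^{a-1}.$$
   Context: $\mathrm{Car}^{(k)}_{n+1}$ is the directed graph (no multiple edges) on vertex set $\{1,\ldots,n+1\}$ with edge set $\{(i,i+1),(i,k+1),\ldots,(i,n):1\le i\le k\}\cup\{(i,i+1),(i,n+1):k+1\le i\le n\}$, directed from smaller to larger vertex. For $\mathbf a=(a_1,\ldots,a_n,-\sum a_i)$ with $a_i\ge0$, $\mathcal F_G(\mathbf a)$ is the set of $(f_e)_{e\in E}\in\mathbb R^E_{\ge0}$ such that at each vertex $j\le n$ the outflow minus the inflow equals $a_j$; here $\mathbf a=(1,\ldots,1,-n)$ has $n$ entries equal to $1$. The normalized volume of a $d$-dimensional polytope is $d!$ times its relative volume with respect to the integer lattice. $\mathrm{Cat}(a,b)=\frac1{a+b}\binom{a+b}{a}$. *)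

(* Defs.v *)
From HB Require Import structures.
From mathcomp Require Import all_boot all_order all_algebra.
From mathcomp Require Import all_classical all_reals all_analysis.

Set Implicit Arguments.
Unset Strict Implicit.
Unset Printing Implicit Defensive.

Import Order.TTheory GRing.Theory Num.Theory.
Local Open Scope classical_set_scope.
Local Open Scope ring_scope.

Section LebesgueTuple.
Variable R : realType.
Local Notation mR := (measurableTypeR R).

Definition tcons (d : nat) (p : mR * d.-tuple mR) : d.+1.-tuple mR :=
  [tuple of p.1 :: p.2].

Lemma measurable_tcons (d : nat) : measurable_fun [set: mR * d.-tuple mR] (@tcons d).
Proof. by apply: measurable_cons. Qed.

Section Step.
Variables (d : nat) (mu : {sigma_finite_measure set (d.-tuple mR) -> \bar R}).

Definition lebesgue_cons : set (d.+1.-tuple mR) -> \bar R :=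
  pushforward (lebesgue_measure \x mu)%E (@tcons d).

Let lebesgue_cons0 : lebesgue_cons set0 = 0%E.
Proof. by rewrite /lebesgue_cons /pushforward preimage_set0 measure0. Qed.

Let lebesgue_cons_ge0 A : (0 <= lebesgue_cons A)%E.
Proof. exact: (measure_ge0 (lebesgue_measure \x mu)%E). Qed.

Let lebesgue_cons_sigma_additive : semi_sigma_additive lebesgue_cons.
Proof.
move=> F mF tF mUF; rewrite /lebesgue_cons /pushforward preimage_bigcup.
apply: measure_semi_sigma_additive.
- by move=> i; rewrite -[X in measurable X]setTI; exact: measurable_tcons.
- apply/trivIsetP => /= i j _ _ ij; rewrite -preimage_setI.
  by move/trivIsetP : tF => /(_ _ _ _ _ ij) ->//; rewrite preimage_set0.
- by rewrite -preimage_bigcup -[X in measurable X]setTI; exact: measurable_tcons.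
Qed.

HB.instance Definition _ := isMeasure.Build _ _ _ lebesgue_cons
  lebesgue_cons0 lebesgue_cons_ge0 lebesgue_cons_sigma_additive.

Let lebesgue_cons_sigma_finite : sigma_finite setT lebesgue_cons.
Proof.
have [F UF Foo] : sigma_finite setT (lebesgue_measure \x mu)%E.
  have /sigma_finiteP[F [TF ndF Foo]] := sigma_finiteT (@lebesgue_measure R).
  have /sigma_finiteP[G [TG ndG Goo]] := sigma_finiteT mu.
  exists (fun i => F i `*` G i).
    rewrite -setXTT TF TG predeqE => -[x y]; split.
      move=> [/= [i _ Fix] [j _ Gjy]]; exists (maxn i j) => //; split.
      - by move: x Fix; exact/subsetPset/ndF/leq_maxl.
      - by move: y Gjy; exact/subsetPset/ndG/leq_maxr.
    by move=> [i _ []/= ? ?]; split; exists i.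
  move=> i; have [? ?] := Foo i; have [? ?] := Goo i.
  split; first exact: measurableX.
  by rewrite product_measure1E// lte_mul_pinfty// ge0_fin_numE.
pose g (t : d.+1.-tuple mR) : mR * d.-tuple mR :=
  (thead t, [tuple of behead t]).
have mg : measurable_fun setT g.
  by apply: measurable_fun_pair; [exact: measurable_tnth|exact: measurable_behead].
have gK (p : mR * d.-tuple mR) : g (tcons p) = p.
  by case: p => x t; rewrite /g theadE; congr pair; apply: val_inj.
exists (fun i => g @^-1` F i); first by rewrite -preimage_bigcup -UF preimage_setT.
move=> i; have [mFi Fioo] := Foo i; split.
  by rewrite -[X in measurable X]setTI; exact: mg.
rewrite /lebesgue_cons /pushforward -comp_preimage.
by rewrite (_ : g \o @tcons d = idfun)//; apply/funext => p /=; rewrite gK.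
Qed.

HB.instance Definition _ := Measure_isSigmaFinite.Build _ _ _ lebesgue_cons
  lebesgue_cons_sigma_finite.

End Step.

(* d-dimensional Lebesgue measure, as an iterated product measure. *)
Fixpoint lebesgue_tuple (d : nat) :
    {sigma_finite_measure set (d.-tuple mR) -> \bar R} :=
  match d with
  | 0 => \d_([tuple] : 0.-tuple mR)
  | d'.+1 => lebesgue_cons (lebesgue_tuple d')
  end.

End LebesgueTuple.

Section NormalizedVolume.
Variables (R : realType) (E : finType).
Implicit Types (P : set {ffun E -> R}) (p y : {ffun E -> R}).

Definition affine_hull P : set {ffun E -> R} :=
  [set y | exists (m : nat) (c : 'I_m -> R) (x : 'I_m -> {ffun E -> R}),
    [/\ \sum_i c i = 1, (forall i, P (x i)) &
        y = [ffun e => \sum_i c i * x i e]]].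

Definition lincomb (d : nat) (B : 'I_d -> {ffun E -> R}) (t : d.-tuple R) :
  {ffun E -> R} := [ffun e => \sum_i tnth t i * B i e].

Definition affine_chart (d : nat) p (B : 'I_d -> {ffun E -> R})
  (t : d.-tuple R) : {ffun E -> R} := [ffun e => p e + lincomb B t e].

(* t |-> p + \sum_i t_i B_i parametrizes the affine hull of P bijectively, and
   its linear part matches Z^d with the integer points of the direction space
   of the hull: the B_i form a Z-basis of that lattice. *)
Definition lattice_chart P (d : nat) p (B : 'I_d -> {ffun E -> R}) : Prop :=
  [/\ injective (affine_chart p B),
      range (affine_chart p B) = affine_hull P &
      forall t : d.-tuple R,
        (forall i, tnth t i \is a Num.int) <->
        (forall e, lincomb B t e \is a Num.int)].

(* d! times the Lebesgue measure of P read in a lattice chart; the value does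
   not depend on the chart, since two charts differ by a translation and an
   element of GL_d(Z). The default 0 is reached when there is no chart, i.e.
   when P is empty or its affine hull is not parallel to a rational subspace. *)
Definition normalized_volume P : \bar R :=
  xget 0%E [set v | exists (d : nat) p (B : 'I_d -> {ffun E -> R}),
    lattice_chart P p B /\
    v = ((d`!)%:R%:E * lebesgue_tuple R d (affine_chart p B @^-1` P))%E].

End NormalizedVolume.

(* Vertex i in {1, ..., n+1} is represented by the ordinal i - 1 : 'I_n.+1. *)
Section Flow.
Variables (n : nat) (G : rel 'I_n.+1).

Definition edge : finType := {e : 'I_n.+1 * 'I_n.+1 | G e.1 e.2}.
Definition src (e : edge) : 'I_n.+1 := (sval e).1.
Definition tgt (e : edge) : 'I_n.+1 := (sval e).2.

Definition flow_polytope (R : realType) (a : 'rV[R]_n.+1) :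
    set {ffun edge -> R} :=
  [set f | (forall e, 0 <= f e) /\
    forall j : 'I_n.+1, (j < n)%N ->
      \sum_(e : edge | src e == j) f e - \sum_(e : edge | tgt e == j) f e
      = a ord0 j].

End Flow.
Arguments flow_polytope {n} G {R} a.

Definition caracol (k n : nat) : rel 'I_n.+1 := fun u v =>
  let i := (u : nat).+1 in let j := (v : nat).+1 in
  [&& (1 <= i)%N, (i <= k)%N &
      (j == i.+1) || ((k.+1 <= j)%N && (j <= n)%N)] ||
  [&& (k.+1 <= i)%N, (i <= n)%N & (j == i.+1) || (j == n.+1)].

Arguments caracol k n : clear implicits.

Definition unit_netflow (R : realType) (n : nat) : 'rV[R]_n.+1 :=
  \row_(j < n.+1) (if (j < n)%N then 1 else - n%:R).

Definition Cat (R : realType) (a b : nat) : R :=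
  (a + b)%:R^-1 * 'C(a + b, a)%:R.

(* Main.v *)
Require Import Defs.
From HB Require Import structures.
From mathcomp Require Import all_boot all_order all_algebra.
From mathcomp Require Import all_classical all_reals all_analysis.
From mathcomp Require Import measurable_realfun ring lra zify.

Import Order.TTheory GRing.Theory Num.Theory numFieldNormedType.Exports.
Local Open Scope classical_set_scope.
Local Open Scope ring_scope.

(* Write a = n - k.  A flow is determined by the k x a matrix x of its values on the edges from
   the first k vertices to the a others, which has total sum k, and by the vector w of its values
   on the a edges into the sink, which has total sum n.  The flow on a path edge is a partial sum
   of 1 - (row sum of x), or of 1 + (column sum of x) - w; both sequences have total sum 0.
   By the cycle lemma exactly one cyclic rotation of the rows, and one simultaneous rotation of
   the columns and of w, makes all these partial sums nonnegative, ties having measure 0.  So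
   the flow polytope is a fundamental domain of Z/k x Z/a acting on a product of two simplices,
   and its volume is 1/(k a) * k^b / b! * n^(a-1) / (a-1)! with b = k a - 1. *)

Set Implicit Arguments.
Unset Strict Implicit.
Unset Printing Implicit Defensive.

(** * Linear change of variables for Lebesgue measure *)

(** [normalized_volume] picks an arbitrary lattice chart, so no volume can be computed before two
    charts are known to give the same value. This and the invariance under rotations follow from one
    fact: an integral affine bijection with integral affine inverse preserves Lebesgue measure.
    Rotations need it because one matrix entry and one weight are eliminated through the totals, and
    a rotation brings them back among the coordinates. The affine hull of the polytope is the whole
    space of conservative flows because some flow is positive on every edge. The same flow shows
    that no partial sum in question vanishes identically, so ties lie on proper hyperplanes. The two
    sequences of steps have totals k - k = 0 and a + k - n = 0. The final constant comes from Cat(a,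
    b) = (a + b - 1)! / (a! b!), where a + b - 1 is the dimension d; the factor 1/k left over from
    1/(k a) lowers k^b to k^(b-1). *)

Section LebesgueTupleTheory.
Variable R : realType.
Local Notation mR := (measurableTypeR R).
Local Notation mu d := (lebesgue_tuple R d).

Lemma tcons_eta d (t : d.+1.-tuple mR) : tcons (thead t, [tuple of behead t]) = t.
Proof. by rewrite /tcons /= -tuple_eta. Qed.

Lemma tnth_tcons0 d x (t : d.-tuple mR) : tnth (tcons (x, t)) ord0 = x.
Proof. by []. Qed.

Lemma tnth_tconsS d x (t : d.-tuple mR) i : tnth (tcons (x, t)) (lift ord0 i) = tnth t i.
Proof. by rewrite /tcons tnthS. Qed.

Lemma thead_tcons d x (t : d.-tuple mR) : thead (tcons (x, t)) = x.
Proof. by []. Qed.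

Lemma behead_tcons d x (t : d.-tuple mR) : [tuple of behead (tcons (x, t))] = t.
Proof. exact: val_inj. Qed.

Lemma tnth_behead_tuple d (t : d.+1.-tuple mR) i :
  tnth [tuple of behead t] i = tnth t (lift ord0 i).
Proof. by rewrite -[in RHS](tcons_eta t) tnth_tconsS. Qed.

Lemma measurable_preimage_tcons d (S : set (d.+1.-tuple mR)) :
  measurable S -> measurable (@tcons R d @^-1` S).
Proof.
by move=> mS; rewrite -[X in measurable X]setTI; exact: measurable_tcons.
Qed.

Lemma lebesgue_tuple_head d (S : set (d.+1.-tuple mR)) : measurable S ->
  mu d.+1 S = (\int[@lebesgue_measure R]_x mu d [set t | S (tcons (x, t))])%E.
Proof.
move=> mS; rewrite /= /lebesgue_cons /pushforward /= /product_measure1.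
by apply: eq_integral => x _ /=; rewrite xsectionE.
Qed.

Lemma lebesgue_tuple_tail d (S : set (d.+1.-tuple mR)) : measurable S ->
  mu d.+1 S = (\int[mu d]_t @lebesgue_measure R [set x | S (tcons (x, t))])%E.
Proof.
move=> mS; rewrite /= /lebesgue_cons /pushforward /=.
rewrite (@product_measure_unique _ _ _ _ _ _ _ (lebesgue_measure \x^ mu d)%E).
- by rewrite /product_measure2; apply: eq_integral => x _ /=; rewrite ysectionE.
- by move=> A B mA mB /=; rewrite product_measure2E.
- exact: measurable_preimage_tcons.
Qed.

Definition line_map (c e : R) (x : mR) : mR := (c * x + e)%R.

Lemma measurable_line_map c e : measurable_fun setT (line_map c e).
Proof. by apply: measurable_funD => //; apply: measurable_funM. Qed.

(** Uniqueness of Lebesgue measure: the scaled pushforward agrees with it on half-open intervals.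
    Positivity of [c] keeps the preimage of such an interval half-open on the same side. *)
Lemma lebesgue_measure_line_map_gt0 (c e : R) (S : set mR) :
  0 < c -> measurable S ->
  (c%:E * @lebesgue_measure R (line_map c e @^-1` S))%E = lebesgue_measure S.
Proof.
move=> c0 mS; apply/esym.
have [m' m'E] : exists m' : {measure set mR -> \bar R}, forall A,
    m' A = (c%:E * @lebesgue_measure R (line_map c e @^-1` A))%E.
  unshelve eexists.
    refine (mscale (NngNum (ltW c0)) (pushforward (@lebesgue_measure R) (line_map c e))).
    exact: measurable_line_map.
  by [].
transitivity (m' S); last by rewrite m'E.
apply: lebesgue_measure_unique mS => _ [[a b]] _ <-.
rewrite m'E.
rewrite (_ : _ @^-1` _ = `](a - e) / c, (b - e) / c]%classic); last first.
  by apply/seteqP; split => x /=; rewrite /line_map !in_itv /=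
    ltr_pdivrMr// ler_pdivlMr// ltrBlDr lerBrDr mulrC.
rewrite !lebesgue_measure_itv /= !lte_fin ltr_pM2r ?invr_gt0// ltrD2r.
case: ifPn => _; last by rewrite mule0.
by rewrite -!EFinB -EFinM; congr EFin; field; exact: lt0r_neq0.
Qed.

Lemma lebesgue_measure_line_map (c e : R) (S : set mR) : c != 0 -> measurable S ->
  (`|c|%:E * @lebesgue_measure R (line_map c e @^-1` S))%E = lebesgue_measure S.
Proof.
move=> c0 mS.
have [c_gt0|c_lt0|c_0] := ltgtP 0 c; last by rewrite -c_0 eqxx in c0.
  by rewrite gtr0_norm// lebesgue_measure_line_map_gt0.
(* A negative slope is a positive one preceded by the reflection x -> -x, which preserves Lebesgue
   measure. *)
have mE : measurable (line_map (- c) e @^-1` S).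
  by rewrite -[X in measurable X]setTI; apply: measurable_line_map.
rewrite -(@lebesgue_measure_line_map_gt0 (- c) e S)// ?oppr_gt0// ltr0_norm//.
congr (_ * _)%E; rewrite -(lebesgue_measureN mE) /pushforward.
congr (lebesgue_measure _).
by apply/seteqP; split => x /=; rewrite /line_map mulrN mulNr opprK.
Qed.

(** Here [c] is the absolute Jacobian of [f]. Stated with preimages and a product, the property
    composes without inverting [f] or dividing in the extended reals. *)
Definition scales d (f : d.-tuple mR -> d.-tuple mR) (c : R) :=
  measurable_fun setT f /\
  forall S, measurable S -> (c%:E * mu d (f @^-1` S))%E = mu d S.

Lemma measurable_preimageT d1 d2 (T1 : measurableType d1) (T2 : measurableType d2)
  (f : T1 -> T2) S : measurable_fun setT f -> measurable S -> measurable (f @^-1` S).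
Proof. by move=> mf mS; rewrite -[X in measurable X]setTI; exact: mf. Qed.

Lemma scales_comp d (f g : d.-tuple mR -> d.-tuple mR) c e :
  scales f c -> scales g e -> scales (g \o f) (c * e).
Proof.
move=> [mf fc] [mg ge]; split; first exact: measurableT_comp.
move=> S mS; rewrite comp_preimage [c * e]mulrC EFinM -muleA fc ?ge//.
exact: measurable_preimageT.
Qed.

Lemma measurable_head_map d (c : R) (h : d.-tuple mR -> mR) :
  measurable_fun setT h -> measurable_fun setT (fun t : d.+1.-tuple mR =>
    tcons ((c * thead t + h [tuple of behead t])%R : mR, [tuple of behead t])).
Proof.
move=> mh; apply: (measurableT_comp (@measurable_tcons R d)).
apply: measurable_fun_pair => /=; last exact: measurable_behead.
apply: measurable_funD.
  by apply: measurable_funM => //; exact: measurable_tnth.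
exact: (measurableT_comp mh (@measurable_behead _ _ _)).
Qed.

(** Fubini with the head integrated innermost: for a fixed tail [t] the map is a line map of slope
    [c] and offset [h t]. *)
Lemma scales_head d (c : R) (h : d.-tuple mR -> mR) :
  c != 0 -> measurable_fun setT h ->
  scales (fun t : d.+1.-tuple mR =>
    tcons ((c * thead t + h [tuple of behead t])%R : mR, [tuple of behead t])) `|c|.
Proof.
move=> c0 mh; split; first exact: measurable_head_map.
move=> S mS; rewrite !lebesgue_tuple_tail//; last first.
  exact: measurable_preimageT (measurable_head_map c mh) mS.
have mT t : measurable [set x : mR | S (tcons (x, t))].
  by have := measurable_ysection t (measurable_preimage_tcons mS); rewrite ysectionE.
rewrite -ge0_integralZl_EFin//.
- apply: eq_integral => t _; rewrite -[RHS](lebesgue_measure_line_map (h t) c0 (mT t)).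
  congr (_ * lebesgue_measure _)%E.
  apply/seteqP; split => x /=; rewrite (_ : [tuple of _] = t)//; exact: val_inj.
- have := measurable_fun_ysection (@lebesgue_measure R)
    (measurable_preimage_tcons (measurable_preimageT (measurable_head_map c mh) mS)).
  by apply: eq_measurable_fun => t _ /=; rewrite ysectionE.
Qed.

(** Fubini with the head integrated outermost: every slice is transformed with the same factor. *)
Lemma scales_tail d (h : mR -> d.-tuple mR -> d.-tuple mR) (c : R) : 0 <= c ->
  let f := fun t : d.+1.-tuple mR =>
    tcons (thead t, h (thead t) [tuple of behead t]) in
  measurable_fun setT f -> (forall x, scales (h x) c) -> scales f c.
Proof.
move=> c0 f mf hc; split => // S mS; rewrite !lebesgue_tuple_head//; last first.
  exact: measurable_preimageT mf mS.
have mT x : measurable [set t : d.-tuple mR | S (tcons (x, t))].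
  by have := measurable_xsection x (measurable_preimage_tcons mS); rewrite xsectionE.
rewrite -ge0_integralZl_EFin//.
- apply: eq_integral => x _; rewrite -[RHS]((hc x).2 _ (mT x)).
  congr (_ * mu d _)%E.
  by apply/seteqP; split => t /=; rewrite /f theadE (_ : [tuple of _] = t)//; exact: val_inj.
- have := measurable_fun_xsection (mu d)
    (measurable_preimage_tcons (measurable_preimageT mf mS)).
  by apply: eq_measurable_fun => t _ /=; rewrite xsectionE.
Qed.

Definition affine_map d (A : 'M[R]_d) (v : 'rV[R]_d) (t : d.-tuple mR) : d.-tuple mR :=
  [tuple v ord0 j + \sum_i tnth t i * A i j | j < d].

Lemma measurable_affine d (c : 'I_d -> R) (e : R) :
  measurable_fun setT (fun t : d.-tuple mR => (e + \sum_i tnth t i * c i)%R : mR).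
Proof.
apply: measurable_funD => //; apply: measurable_sum => i.
by apply: measurable_funM => //; exact: measurable_tnth.
Qed.

Lemma measurable_affine_map d (A : 'M[R]_d) v : measurable_fun setT (affine_map A v).
Proof.
apply/measurable_fun_tnthP => j; rewrite (_ : _ \o _ =
  fun t : d.-tuple mR => (v ord0 j + \sum_i tnth t i * A i j)%R : mR).
  exact: measurable_affine.
by apply/funext => t /=; rewrite tnth_mktuple.
Qed.

(* Gaussian elimination: [a, a u; v, v u + S] = [a, 0; v, 1] [1, u; 0, S]. *)
Lemma scales_affine_map_step d (A : 'M[R]_(1 + d)) (v : 'rV[R]_(1 + d)) :
  (forall (B : 'M[R]_d) w, B \in unitmx -> scales (affine_map B w) `|\det B|) ->
  A \in unitmx -> A ord0 ord0 != 0 -> scales (affine_map A v) `|\det A|.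
Proof.
move=> IH uA a0; set a := A ord0 ord0.
pose u : 'rV[R]_d := a^-1 *: ursubmx A.
pose w : 'cV[R]_d := dlsubmx A.
pose S : 'M[R]_d := drsubmx A - w *m u.
have Edet : \det A = a * \det S.
  have -> : A = block_mx a%:M 0 w 1%:M *m block_mx 1%:M u 0 S.
    rewrite mulmx_block !mul0mx !mulmx0 !addr0 !mulmx1 !mul1mx.
    rewrite mul_scalar_mx /u scalerA mulfV// scale1r /S addrC subrK.
    rewrite -[LHS]submxK; congr block_mx.
    by apply/matrixP => i j; rewrite !ord1 !mxE/= lshift0.
  by rewrite det_mulmx det_lblock det_ublock !det1 det_scalar1 mulr1 mul1r.
have uS : S \in unitmx.
  by rewrite unitmxE unitfE; move: uA; rewrite unitmxE unitfE Edet mulf_eq0 => /norP[].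
pose f := fun t : d.+1.-tuple mR => tcons
  ((a * thead t + (v ord0 ord0 + \sum_i tnth [tuple of behead t] i * w i ord0))%R : mR,
   [tuple of behead t]).
(* The head produced by [f] already contains [v ord0 ord0]; subtracting that multiple of [u] cancels
   what [x *: u] would add in excess. *)
pose h (x : mR) := affine_map S (rsubmx v - v ord0 ord0 *: u + x *: u).
pose g := fun t : d.+1.-tuple mR => tcons (thead t, h (thead t) [tuple of behead t]).
have fa : scales f `|a| by exact: (scales_head a0 (measurable_affine _ _)).
have mg : measurable_fun setT g.
  apply/measurable_fun_tnthP => j; have [{}j ->|->] := unliftP ord0 j; last first.
    exact: measurable_tnth.
  pose B : 'M[R]_(1 + d) := block_mx 1%:M u 0 S.
  have B0 : B ord0 (rshift 1 j) = u ord0 j.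
    rewrite -(block_mxEur 1%:M u 0 S ord0 j).
    by congr (fun_of_matrix _ _); exact/val_inj.
  have BS i : B (lift ord0 i) (rshift 1 j) = S i j by rewrite -rshift1 block_mxEdr.
  rewrite (_ : _ \o _ = fun t : d.+1.-tuple mR =>
    ((rsubmx v - v ord0 ord0 *: u) ord0 j + \sum_i tnth t i * B i (rshift 1 j))%R : mR).
    exact: measurable_affine.
  apply/funext => t /=; rewrite -[t]tcons_eta tnth_tconsS tnth_mktuple.
  rewrite big_ord_recl /= !tnth_tcons0 /= B0 [X in X + _ = _]mxE -addrA.
  congr (_ + (_ + _)); first by rewrite mxE.
  apply: eq_bigr => i _; rewrite tnth_tconsS BS.
  by congr (tnth _ _ * _); apply/val_inj.
have gS : scales g `|\det S|.
  by apply: scales_tail => // x; exact: IH.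
have Eu j : A ord0 (lift ord0 j) = a * u ord0 j.
  rewrite !mxE mulrA mulfV// mul1r -rshift1.
  by congr (fun_of_matrix _ _); exact/val_inj.
have Ew i : w i ord0 = A (lift ord0 i) ord0.
  by rewrite !mxE -rshift1; congr (fun_of_matrix _ _); exact/val_inj.
have ES i j : A (lift ord0 i) (lift ord0 j) = S i j + w i ord0 * u ord0 j.
  by rewrite /S !mxE big_ord1 -!rshift1 !mxE subrK.
have Er (u' : 'rV[R]_d) x j : (rsubmx v - v ord0 ord0 *: u' + x *: u') ord0 j =
    v ord0 (lift ord0 j) - v ord0 ord0 * u' ord0 j + x * u' ord0 j.
  by rewrite !mxE rshift1.
have -> : affine_map A v = g \o f.
  apply/funext => t; apply: eq_from_tnth => j; rewrite tnth_mktuple [(g \o f) t]/= /g /f.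
  rewrite thead_tcons behead_tcons /= big_ord_recl.
  under [X in a * _ + (_ + X)]eq_bigr do rewrite tnth_behead_tuple.
  have [{}j ->|->] := unliftP ord0 j.
    rewrite tnth_tconsS tnth_mktuple /= Eu.
    under eq_bigr do rewrite ES mulrDr mulrA.
    under [X in _ = _ + X]eq_bigr do rewrite tnth_behead_tuple.
    rewrite big_split /= -mulr_suml -rshift1.
    move: (\sum_i _) (\sum_i _) => s1 s2.
    by rewrite Er rshift1 /thead; ring.
  rewrite tnth_tcons0 /=; under eq_bigr do rewrite -Ew.
  by rewrite mulrC addrCA.
rewrite Edet normrM; exact: scales_comp.
Qed.

Lemma scales_affine_map d (A : 'M[R]_d) v : A \in unitmx -> scales (affine_map A v) `|\det A|.
Proof.
elim: d A v => [|d IH] A v uA.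
  split; first exact: measurable_affine_map.
  move=> S mS; rewrite det_mx00 normr1 mul1e; congr (mu 0 _).
  by apply/funext => t /=; rewrite (_ : affine_map A v t = t)//; apply: eq_from_tnth; case.
have [a0|a0] := eqVneq (A ord0 ord0) 0; last exact: (@scales_affine_map_step d).
have [j Aj] : exists j : 'I_d, A ord0 (lift ord0 j) != 0.
  apply: contrapT => /forallNP A0; move: uA; rewrite unitmxE unitfE.
  rewrite (expand_det_row _ ord0) big1 ?eqxx// => j _.
  have [{}j ->|->] := unliftP ord0 j; last by rewrite a0 mul0r.
  by move: (A0 j) => /negP; rewrite negbK => /eqP ->; rewrite mul0r.
(* Pivoting: right multiplication by [E] adds the column of a nonzero entry of row 0 to column 0.
   The shear in [fE] undoes it on the image side. *)
pose E : 'M[R]_(d.+1) := 1%:M + delta_mx (lift ord0 j) ord0.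
have detE : \det E = 1.
  rewrite det_trig.
    by apply: big1 => i _; rewrite !mxE eqxx; case: eqVneq => [->|]//=; rewrite addr0.
  apply/is_trig_mxP => i k ik; rewrite !mxE -val_eqE (ltn_eqF ik) add0r.
  by case: eqVneq => //= _; case: eqVneq ik => // ->; rewrite ltn0.
pose B := A *m E; pose v' := v *m E.
have AE m (C : 'M[R]_(m, d.+1)) i k :
    (C *m E) i k = C i k + C i (lift ord0 j) * (k == ord0)%:R.
  rewrite mulmxDr mulmx1 !mxE; congr (_ + _).
  rewrite (bigD1 (lift ord0 j)) //= big1 => [|l /negPf lj].
    by rewrite mxE eqxx addr0.
  by rewrite mxE lj mulr0.
have detB : \det B = \det A by rewrite det_mulmx detE mulr1.
have uB : B \in unitmx by rewrite unitmxE detB.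
have B0 : B ord0 ord0 != 0 by rewrite AE eqxx mulr1 a0 add0r.
have fE : scales (fun t : d.+1.-tuple mR =>
    tcons ((1 * thead t + - tnth [tuple of behead t] j)%R : mR, [tuple of behead t])) `|1|.
  apply: (@scales_head d 1 (fun t => (- tnth t j)%R : mR)); first exact: oner_neq0.
  exact: (measurableT_comp _ (@measurable_tnth _ mR d j)).
have := scales_comp (@scales_affine_map_step d B v' IH uB B0) fE.
rewrite detB normr1 mulr1; congr scales.
apply/funext => t; apply: eq_from_tnth => k; rewrite compE.
have [{}k ->|->] := unliftP ord0 k.
  rewrite tnth_tconsS tnth_behead_tuple !tnth_mktuple AE mulr0 addr0.
  by congr (_ + _); apply: eq_bigr => i _; rewrite AE mulr0 addr0.
rewrite tnth_tcons0 tnth_behead_tuple mul1r /thead !tnth_mktuple !AE.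
rewrite eqxx mulr1 mulr0 addr0 opprD addrACA addrK; congr (_ + _).
rewrite -sumrB; apply: eq_bigr => i _.
by rewrite !AE eqxx mulr1 mulr0 addr0 -mulrBr addrK.
Qed.

End LebesgueTupleTheory.

(** * Integral affine maps and volumes of simplices *)

Section IntAffine.
Variable R : realType.
Local Notation mR := (measurableTypeR R).
Local Notation mu d := (lebesgue_tuple R d).

(** Only the linear part is integral: the base point of a lattice chart may be any real point, and
    translations do not change volume. *)
Definition int_affine d (f : d.-tuple R -> R) :=
  exists2 c : 'I_d -> R, forall i, c i \is a Num.int &
  exists e, forall t, f t = e + \sum_i tnth t i * c i.

Lemma int_affine_eq d (f g : d.-tuple R -> R) : f =1 g -> int_affine f -> int_affine g.
Proof. by move=> fg [c ci [e fE]]; exists c => //; exists e => t; rewrite -fg. Qed.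

Lemma int_affine_cst d e : int_affine (fun _ : d.-tuple R => e).
Proof.
exists (fun=> 0) => [i|]; first exact: rpred0.
by exists e => t; rewrite big1 ?addr0// => i _; rewrite mulr0.
Qed.

Lemma int_affine_tnth d (i : 'I_d) : int_affine (fun t => tnth t i).
Proof.
exists (fun j => (j == i)%:R) => [j|]; first exact: natr_int.
exists 0 => t; rewrite add0r (bigD1 i)//= eqxx mulr1 big1 ?addr0// => j /negPf ->.
by rewrite mulr0.
Qed.

Lemma int_affineD d (f g : d.-tuple R -> R) :
  int_affine f -> int_affine g -> int_affine (fun t => f t + g t).
Proof.
move=> [c ci [e fE]] [c' ci' [e' gE]]; exists (fun i => c i + c' i).
  by move=> i; rewrite rpredD.
exists (e + e') => t; rewrite fE gE addrACA -big_split /=; congr (_ + _).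
by apply: eq_bigr => i _; rewrite mulrDr.
Qed.

Lemma int_affineN d (f : d.-tuple R -> R) : int_affine f -> int_affine (fun t => - f t).
Proof.
move=> [c ci [e fE]]; exists (fun i => - c i) => [i|]; first by rewrite rpredN.
exists (- e) => t; rewrite fE opprD -sumrN; congr (_ + _).
by apply: eq_bigr => i _; rewrite mulrN.
Qed.

Lemma int_affineB d (f g : d.-tuple R -> R) :
  int_affine f -> int_affine g -> int_affine (fun t => f t - g t).
Proof. by move=> af ag; apply: int_affineD => //; exact: int_affineN. Qed.

Lemma int_affine_sum d (I : Type) (r : seq I) (P : pred I) (f : I -> d.-tuple R -> R) :
  (forall i, P i -> int_affine (f i)) -> int_affine (fun t => \sum_(i <- r | P i) f i t).
Proof.
move=> af; elim: r => [|i r IH].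
  by apply: int_affine_eq (int_affine_cst _ 0) => t; rewrite big_nil.
have [Pi|Pi] := boolP (P i).
  by apply: int_affine_eq (int_affineD (af i Pi) IH) => t; rewrite big_cons Pi.
by apply: int_affine_eq IH => t; rewrite big_cons (negPf Pi).
Qed.

Lemma measurable_int_affine d (f : d.-tuple R -> R) :
  int_affine f -> measurable_fun [set: d.-tuple mR] (f : _ -> mR).
Proof.
move=> [c _ [e fE]]; rewrite (_ : f = fun t => e + \sum_i tnth t i * c i).
  exact: measurable_affine.
exact/funext.
Qed.

Definition row_of_tuple d (t : d.-tuple R) : 'rV[R]_d := \row_i tnth t i.

Lemma row_of_tupleK d (x : 'rV[R]_d) : row_of_tuple [tuple x ord0 i | i < d] = x.
Proof. by apply/rowP => i; rewrite mxE tnth_mktuple. Qed.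

Lemma int_affine_matrix d d' (g : d.-tuple R -> d'.-tuple R) :
  (forall j, int_affine (fun t => tnth (g t) j)) ->
  exists (A : 'M[R]_(d, d')) (v : 'rV[R]_d'), (forall i j, A i j \is a Num.int) /\
    forall t, row_of_tuple (g t) = v + row_of_tuple t *m A.
Proof.
move=> ag; have : forall j, exists p : ('I_d -> R) * R, (forall i, p.1 i \is a Num.int) /\
    forall t, tnth (g t) j = p.2 + \sum_i tnth t i * p.1 i.
  by move=> j; have [c ci [e E]] := ag j; exists (c, e).
move=> /choice[p pP]; exists (\matrix_(i, j) (p j).1 i), (\row_j (p j).2); split.
  by move=> i j; rewrite mxE; have [] := pP j.
move=> t; apply/rowP => j; rewrite !mxE; have [_ ->] := pP j; congr (_ + _).
by apply: eq_bigr => i _; rewrite !mxE.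
Qed.

Lemma row_affine_id d (B : 'M[R]_d) (w : 'rV[R]_d) :
  (forall x : 'rV[R]_d, w + x *m B = x) -> B = 1%:M.
Proof.
move=> H; have w0 : w = 0 by have := H 0; rewrite mul0mx addr0.
by apply/row_matrixP => i; rewrite rowE -[RHS]H w0 add0r rowE mulmx1.
Qed.

Lemma cancel_matrix d d' (g : d.-tuple R -> d'.-tuple R) (h : d'.-tuple R -> d.-tuple R)
    (A : 'M[R]_(d, d')) (v : 'rV[R]_d') (A' : 'M[R]_(d', d)) (v' : 'rV[R]_d) :
  (forall t, row_of_tuple (g t) = v + row_of_tuple t *m A) ->
  (forall t, row_of_tuple (h t) = v' + row_of_tuple t *m A') ->
  cancel g h -> A *m A' = 1%:M.
Proof.
move=> gE hE gK; apply: (@row_affine_id _ _ (v' + v *m A')) => x.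
rewrite -[in LHS](row_of_tupleK x) mulmxA -addrA -mulmxDl -gE -hE gK.
exact: row_of_tupleK.
Qed.

(** The linear parts are mutually inverse matrices, hence square. This is needed because a lattice
    chart comes with its own dimension. *)
Lemma int_affine_bij_dim d d' (g : d.-tuple R -> d'.-tuple R) (h : d'.-tuple R -> d.-tuple R) :
  (forall j, int_affine (fun t => tnth (g t) j)) ->
  (forall j, int_affine (fun t => tnth (h t) j)) ->
  cancel g h -> cancel h g -> d = d'.
Proof.
move=> /int_affine_matrix[A [v [_ gE]]] /int_affine_matrix[A' [v' [_ hE]]] gK hK.
apply/eqP; rewrite eqn_leq (mulmx1_min (cancel_matrix gE hE gK)).
exact: (mulmx1_min (cancel_matrix hE gE hK)).
Qed.

Lemma det_int d (A : 'M[R]_d) : (forall i j, A i j \is a Num.int) -> \det A \is a Num.int.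
Proof.
move=> Ai; apply: rpred_sum => s _; rewrite rpredMsign.
by apply: rpred_prod => i _.
Qed.

(** The linear parts have integer determinants with product 1, so the Jacobian is 1 in absolute
    value. *)
Lemma int_affine_bij_measure d (g h : d.-tuple R -> d.-tuple R) (S : set (d.-tuple mR)) :
  (forall j, int_affine (fun t => tnth (g t) j)) ->
  (forall j, int_affine (fun t => tnth (h t) j)) ->
  cancel g h -> measurable S -> mu d (g @^-1` S) = mu d S.
Proof.
move=> /int_affine_matrix[A [v [Ai gE]]] /int_affine_matrix[A' [v' [A'i hE]]] gK mS.
have AA' := cancel_matrix gE hE gK; have [uA _] := mulmx1_unit AA'.
have detA : `|\det A| = 1.
  have det1AA' : `|\det A| * `|\det A'| = 1 by rewrite -normrM -det_mulmx AA' det1 normr1.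
  have := norm_intr_ge1 (det_int Ai); have := norm_intr_ge1 (det_int A'i).
  have nA : \det A != 0 by apply/eqP => A0; move: det1AA'; rewrite A0 normr0; lra.
  have nA' : \det A' != 0 by apply/eqP => A0; move: det1AA'; rewrite A0 normr0; lra.
  by move=> /(_ nA') ? /(_ nA) ?; nra.
have gA : (g : d.-tuple mR -> d.-tuple mR) = affine_map A v.
  apply/funext => t; apply: eq_from_tnth => j; rewrite tnth_mktuple.
  have /rowP/(_ j) := gE t; rewrite !mxE => ->; congr (_ + _).
  by apply: eq_bigr => i _; rewrite mxE.
by have [_ /(_ _ mS)] := scales_affine_map v uA; rewrite detA mul1e gA.
Qed.

End IntAffine.

(** * Null hyperplanes and the volume of a product of two simplices *)

Section Volumes.
Variable R : realType.
Local Notation mR := (measurableTypeR R).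
Local Notation mu d := (lebesgue_tuple R d).

(** If some tail coefficient is nonzero, the slices at a fixed head are hyperplanes of lower
    dimension. Otherwise the equation fixes the head, and the slices at a fixed tail are single
    points. *)
Lemma lebesgue_tuple_hyperplane d (c : 'I_d -> R) (e : R) :
  (exists i, c i != 0) ->
  mu d [set t : d.-tuple mR | e + \sum_i tnth t i * c i = 0] = 0%E.
Proof.
elim: d c e => [c e [[]//]|d IH c e [i ci]].
have mS : measurable [set t : d.+1.-tuple mR | e + \sum_i tnth t i * c i = 0].
  have := measurable_preimageT (@measurable_affine R _ c e) (measurable_set1 (0 : mR)).
  by [].
have [[j cj]|/forallNP c0] := pselect (exists j, c (lift ord0 j) != 0).
  rewrite lebesgue_tuple_head//; apply: integral0_eq => x _.
  rewrite -[RHS](IH (fun j => c (lift ord0 j)) (e + x * c ord0)); last by exists j.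
  congr (mu d _); apply/funext => t /=; congr (_ = 0).
  rewrite big_ord_recl tnth_tcons0 addrA; congr (_ + _).
  by apply: eq_bigr => l _; rewrite tnth_tconsS.
have {}ci : c ord0 != 0.
  by move: ci; have [j ->|->//] := unliftP ord0 i => cj; case: (c0 j).
rewrite lebesgue_tuple_tail//; apply: integral0_eq => t _.
rewrite (_ : [set x | _] = [set - e / c ord0]) ?lebesgue_measure_set1//.
have E x : \sum_i tnth (tcons (x, t)) i * c i = x * c ord0.
  rewrite big_ord_recl tnth_tcons0 big1 ?addr0// => l _.
  by have := c0 l; move/negP; rewrite negbK => /eqP ->; rewrite mulr0.
apply/seteqP; split => x /=; rewrite E.
  move=> /eqP; rewrite addr_eq0 => /eqP ->; rewrite opprK.
  by field.
by move=> ->; field.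
Qed.

Lemma integral_pow (s : R) m (a : R) : 0 <= s ->
  (\int[@lebesgue_measure R]_(x in `[0%R, s]) (a * (s - x) ^+ m)%:E =
   (a * (s ^+ m.+1 / m.+1%:R))%:E)%E.
Proof.
rewrite le_eqVlt => /orP[/eqP <-|s0].
  rewrite set_itv1 integral_set1 //.
  by rewrite expr0n mul0r mulr0.
(* An antiderivative of the integrand, taken as a polynomial so that its derivative and continuity
   are algebraic facts. *)
pose p : {poly R} := (- a / m.+1%:R) *: (s%:P - 'X) ^+ m.+1.
have pE x : p.[x] = - a * ((s - x) ^+ m.+1 / m.+1%:R) 
  by rewrite hornerZ horner_exp hornerD hornerN hornerC hornerX -mulrA [_^-1 * _]mulrC.
have p'E : p^`() = a *: (s%:P - 'X) ^+ m.
  rewrite derivZ deriv_exp derivB derivC derivX sub0r mulN1r mulNrn.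
  rewrite -(scaler_nat m.+1 (_ ^+ _)) scalerN scalerA -scaleNr; congr (_ *: _).
  by field; rewrite nat1r pnatr_eq0.
transitivity (\int[@lebesgue_measure R]_(x in `[0%R, s]) (p^`().[x])%:E)%E.
  apply: eq_integral => x _; congr EFin.
  by rewrite p'E hornerZ horner_exp hornerD hornerN hornerC hornerX.
have dp : derivable_oo_LRcontinuous (horner p) 0 s.
  split.
  + by move=> x _; exact: derivable_horner.
  + by apply: cvg_at_right_filter; exact: continuous_horner.
  + by apply: cvg_at_left_filter; exact: continuous_horner.
rewrite (@continuous_FTC2 _ _ (horner p))//.
- rewrite -EFinB !pE subrr subr0 expr0n /= mul0r mulr0 sub0r mulNr opprK//.
- by apply: continuous_subspaceT => x; exact: continuous_horner.
- by move=> x _; rewrite derivE.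
Qed.

(** The parameter of [T] is the budget left once the head has used [x] of [s]. The exponent [m] is
    separate from [d] because only some tail coordinates need draw on that budget. *)
Lemma lebesgue_tuple_cone d m (a s : R) (S : set (d.+1.-tuple mR))
    (T : R -> set (d.-tuple mR)) :
  0 <= s -> measurable S ->
  (forall x t, S (tcons (x, t)) <-> 0 <= x <= s /\ T (s - x) t) ->
  (forall s', 0 <= s' -> mu d (T s') = (a * s' ^+ m)%:E) ->
  mu d.+1 S = (a * (s ^+ m.+1 / m.+1%:R))%:E.
Proof.
move=> s0 mS ST muT; rewrite lebesgue_tuple_head// -integral_pow// [RHS]integral_mkcond.
apply: eq_integral => x _; rewrite patchE.
case: ifPn => [|/negP xs].
  rewrite inE /= in_itv /= => xs; rewrite -muT ?subr_ge0; last by case/andP: xs.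
  congr (mu d _); apply/seteqP; split => t /=; first by move=> /ST[].
  by move=> Tt; apply/ST.
transitivity (mu d set0); last exact: measure0.
congr (mu d _); rewrite -subset0 => t /= /ST[xs' _].
by apply: xs; rewrite inE /= in_itv.
Qed.

Lemma measurable_forall d (T : measurableType d) (I : finType) (P : I -> set T) :
  (forall i, measurable (P i)) -> measurable [set t | forall i, P i t].
Proof.
move=> mP; rewrite (_ : [set t | _] = \bigcap_(i in setT) P i).
  by apply: fin_bigcap_measurable => // i _; exact: mP.
by apply/seteqP; split => t /= Pt i => [_|]; exact: Pt.
Qed.

Lemma measurable_int_affine_ge0 d (f : d.-tuple R -> R) :
  int_affine f -> measurable [set t : d.-tuple mR | 0 <= f t].
Proof.
move=> /measurable_int_affine mf.
have := measurable_preimageT mf (measurable_itv `[0, +oo[).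
by congr measurable; apply/funext => t /=; rewrite in_itv /= andbT.
Qed.

Lemma measurable_int_affine_gt0 d (f : d.-tuple R -> R) :
  int_affine f -> measurable [set t : d.-tuple mR | 0 < f t].
Proof.
move=> /measurable_int_affine mf.
have := measurable_preimageT mf (measurable_itv `]0, +oo[).
by congr measurable; apply/funext => t /=; rewrite in_itv /= andbT.
Qed.

Lemma int_affine_nth d i : int_affine (fun t : d.-tuple R => t`_i).
Proof.
have [id|di] := ltnP i d.
  apply: int_affine_eq (int_affine_tnth R (Ordinal id)) => t.
  by rewrite (tnth_nth 0).
by apply: int_affine_eq (int_affine_cst _ 0) => t; rewrite nth_default ?size_tuple.
Qed.

(** The sums are bounded rather than prescribed because each simplex has lost its last coordinate,
    which is the slack. *)
Definition simplex_prod m1 m2 (s1 s2 : R) : set ((m1 + m2).-tuple mR) :=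
  [set t | (forall i, 0 <= tnth t i) /\
           \sum_(0 <= i < m1) t`_i <= s1 /\ \sum_(m1 <= i < m1 + m2) t`_i <= s2].

Arguments simplex_prod : clear implicits.

Lemma measurable_simplex_prod m1 m2 s1 s2 : measurable (simplex_prod m1 m2 s1 s2).
Proof.
have mle (I : seq nat) s :
    measurable [set t : (m1 + m2).-tuple mR | \sum_(i <- I) t`_i <= s].
  have -> : [set t : (m1 + m2).-tuple mR | \sum_(i <- I) t`_i <= s] =
      [set t | 0 <= s - \sum_(i <- I) t`_i].
    by apply/funext => t /=; rewrite subr_ge0.
  apply: measurable_int_affine_ge0; apply: int_affineB; first exact: int_affine_cst.
  by apply: int_affine_sum => i _; exact: int_affine_nth.
rewrite (_ : simplex_prod _ _ _ _ = [set t | forall i, 0 <= tnth t i] `&`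
  ([set t | \sum_(0 <= i < m1) t`_i <= s1] `&`
   [set t | \sum_(m1 <= i < m1 + m2) t`_i <= s2]))//.
apply: measurableI; last by apply: measurableI; exact: mle.
by apply: measurable_forall => i; apply: measurable_int_affine_ge0; exact: int_affine_tnth.
Qed.

Lemma tcons_ge0 d x (t : d.-tuple mR) :
  (forall i, (0 : R) <= tnth (tcons (x, t)) i) <-> (0 : R) <= x /\ forall i, (0 : R) <= tnth t i.
Proof.
split=> [H|[x0 t0] i].
  by split=> [|i]; [exact: (H ord0)|rewrite -(tnth_tconsS x); exact: H].
by have [{}i ->|->] := unliftP ord0 i; rewrite ?tnth_tconsS ?tnth_tcons0.
Qed.

Lemma lebesgue_simplex_prod m1 m2 (s1 s2 : R) : 0 <= s1 -> 0 <= s2 ->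
  mu (m1 + m2) (simplex_prod m1 m2 s1 s2) =
  ((s1 ^+ m1 / m1`!%:R) * (s2 ^+ m2 / m2`!%:R))%:E.
Proof.
have sumt_ge0 d (t : d.-tuple mR) (I : seq nat) :
    (forall i, (0 : R) <= tnth t i) -> (0 : R) <= \sum_(i <- I) t`_i.
  move=> t0; apply: sumr_ge0 => i _; have [id|di] := ltnP i d.
    by have := t0 (Ordinal id); rewrite (tnth_nth 0).
  by rewrite nth_default ?size_tuple.
elim: m1 s1 => [|m1 IH] s1 s1_ge0 s2_ge0.
  elim: m2 s2 s2_ge0 => [|m2 IH] s2 s2_ge0.
    rewrite !expr0 !divr1 mulr1 /= diracE mem_set//.
    by split; [case|rewrite !big_nil].
  rewrite [LHS](@lebesgue_tuple_cone m2 m2 (s1 ^+ 0 / 0`!%:R * m2`!%:R^-1) s2 _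
    (simplex_prod 0 m2 s1)) //.
  - congr EFin; rewrite factS natrM; field.
    by rewrite nat1r !pnatr_eq0 -lt0n fact_gt0.
  - exact: (@measurable_simplex_prod 0 m2.+1 s1 s2).
  - move=> x t.
    have E : \sum_(0 <= i < 0 + m2.+1) (tcons (x, t) : seq R)`_i =
        x + \sum_(0 <= i < 0 + m2) t`_i by rewrite !add0n big_nat_recl.
    split=> [[/tcons_ge0[x0 t0] [s10 ts]]|[/andP[x0 xs] [t0 [s10 ts]]]].
      have {}ts : x + \sum_(0 <= i < 0 + m2) t`_i <= s2 by rewrite -E; exact: ts.
      have := sumt_ge0 _ t (index_iota 0 (0 + m2)) t0 => t0'.
      split; first by apply/andP; split => //; lra.
      split; first exact: t0.
      by split; [rewrite big_nil|rewrite lerBrDl; exact: ts].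
    split; first exact/tcons_ge0.
    split; first by rewrite big_nil.
    suff : x + \sum_(0 <= i < 0 + m2) t`_i <= s2 by rewrite -E.
    by rewrite -lerBrDl; exact: ts.
  - move=> s' s'0; rewrite IH//; congr EFin; ring.
(* The second simplex is a constant factor while the coordinates of the first one are peeled off. *)
rewrite [LHS](@lebesgue_tuple_cone (m1 + m2) m1 (s2 ^+ m2 / m2`!%:R * m1`!%:R^-1) s1 _
    (fun s => simplex_prod m1 m2 s s2)) //.
- congr EFin; rewrite factS natrM; field.
  by rewrite nat1r !pnatr_eq0 -!lt0n !fact_gt0.
- exact: (@measurable_simplex_prod m1.+1 m2 s1 s2).
- move=> x t.
  have E1 : \sum_(0 <= i < m1.+1) (tcons (x, t) : seq R)`_i =
      x + \sum_(0 <= i < m1) t`_i by rewrite big_nat_recl.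
  have E2 : \sum_(m1.+1 <= i < m1.+1 + m2) (tcons (x, t) : seq R)`_i =
      \sum_(m1 <= i < m1 + m2) t`_i by rewrite addSn big_add1.
  split=> [[/tcons_ge0[x0 t0] [ts1 ts]]|[/andP[x0 xs] [t0 [ts1 ts]]]].
    have {}ts1 : x + \sum_(0 <= i < m1) t`_i <= s1 by rewrite -E1; exact: ts1.
    have := sumt_ge0 _ t (index_iota 0 m1) t0 => t0'.
    split; first by apply/andP; split => //; lra.
    split; first exact: t0.
    by split; [rewrite lerBrDl; exact: ts1|rewrite -E2; exact: ts].
  split; first exact/tcons_ge0.
  split; last by move: ts; rewrite -E2; apply.
  suff : x + \sum_(0 <= i < m1) t`_i <= s1 by rewrite -E1.
  by rewrite -lerBrDl; exact: ts1.
- move=> s' s'0; rewrite IH//; congr EFin; ring.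
Qed.

End Volumes.

(** * Independence of the normalized volume from the chart *)

Section Charts.
Variables (R : realType) (E : finType).
Local Notation mR := (measurableTypeR R).
Local Notation mu d := (lebesgue_tuple R d).
Implicit Types (P : set {ffun E -> R}).

Definition unit_tuple d (i : 'I_d) : d.-tuple R := [tuple (j == i)%:R | j < d].

Lemma int_affine_chart d (Phi : d.-tuple R -> {ffun E -> R}) :
  (forall e, int_affine (fun t => Phi t e)) ->
  exists p (B : 'I_d -> {ffun E -> R}),
    (forall i e, B i e \is a Num.int) /\ forall t, Phi t = affine_chart p B t.
Proof.
move=> aff; have : forall e, exists q : ('I_d -> R) * R,
    (forall i, q.1 i \is a Num.int) /\ forall t, Phi t e = q.2 + \sum_i tnth t i * q.1 i.
  by move=> e; have [c ci [e0 eE]] := aff e; exists (c, e0).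
move=> /choice[q qP]; exists [ffun e => (q e).2], (fun i => [ffun e => (q e).1 i]); split.
  by move=> i e; rewrite ffunE; have [] := qP e.
move=> t; apply/ffunP => e; rewrite !ffunE; have [_ ->] := qP e; congr (_ + _).
by apply: eq_bigr => i _; rewrite ffunE.
Qed.

Lemma lincomb_unit_tuple d (B : 'I_d -> {ffun E -> R}) i : lincomb B (unit_tuple i) = B i.
Proof.
apply/ffunP => e; rewrite ffunE (bigD1 i)//= tnth_mktuple eqxx mul1r big1 ?addr0//.
by move=> j /negPf ji; rewrite tnth_mktuple ji mul0r.
Qed.

Lemma int_affine_affine_chart d p (B : 'I_d -> {ffun E -> R}) :
  (forall i e, B i e \is a Num.int) ->
  forall e, int_affine (fun t => affine_chart p B t e).
Proof.
move=> Bi e; exists (fun i => B i e) => //; exists (p e) => t.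
by rewrite !ffunE.
Qed.

Lemma affine_chartB d p (B : 'I_d -> {ffun E -> R}) (t u : d.-tuple R) e :
  affine_chart p B t e - affine_chart p B u e =
  lincomb B [tuple tnth t i - tnth u i | i < d] e.
Proof.
rewrite !ffunE opprD addrACA subrr add0r -sumrB; apply: eq_bigr => i _.
by rewrite tnth_mktuple mulrBl.
Qed.

Lemma lattice_chart_int P d p (B : 'I_d -> {ffun E -> R}) i e :
  lattice_chart P p B -> B i e \is a Num.int.
Proof.
case=> _ _ /(_ (unit_tuple i))[+ _]; rewrite lincomb_unit_tuple; apply => j.
by rewrite tnth_mktuple; exact: natr_int.
Qed.

(** The increment of [h] along a unit vector is sent by [lincomb B] to an integral vector, so the
    lattice condition makes it integral. That [h] is affine at all comes from injectivity of the
    chart. *)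
Lemma int_affine_chart_inv P d d' p (B : 'I_d -> {ffun E -> R})
    (Phi : d'.-tuple R -> {ffun E -> R}) (h : d'.-tuple R -> d.-tuple R) :
  lattice_chart P p B -> (forall e, int_affine (fun t => Phi t e)) ->
  (forall t, affine_chart p B (h t) = Phi t) ->
  forall i, int_affine (fun t => tnth (h t) i).
Proof.
move=> ch aff hE i; have [p' [B' [B'i PhiE]]] := int_affine_chart aff.
have [Binj _ Blat] := ch.
pose z : d'.-tuple R := [tuple 0 | _ < d'].
pose dh j := [tuple tnth (h (unit_tuple j)) l - tnth (h z) l | l < d].
have dhE j : lincomb B (dh j) = B' j.
  apply/ffunP => e; rewrite -(affine_chartB p) !hE !PhiE affine_chartB.
  rewrite -[in RHS](lincomb_unit_tuple B' j); congr (lincomb B' _ e).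
  by apply: eq_from_tnth => l; rewrite !tnth_mktuple subr0.
exists (fun j => tnth (dh j) i) => [j|].
  by move: i; apply/Blat => e; rewrite dhE.
exists (tnth (h z) i) => t.
(* The affine extrapolation of [h] from the origin and the unit vectors; it has the same image under
   the chart as [h t]. *)
pose u : d.-tuple R := [tuple tnth (h z) l + \sum_j tnth t j * tnth (dh j) l | l < d].
suff -> : h t = u by rewrite tnth_mktuple.
apply: Binj; rewrite hE PhiE; apply/ffunP => e.
rewrite -[LHS](subrK (affine_chart p' B' z e)) affine_chartB.
rewrite -[RHS](subrK (affine_chart p B (h z) e)) affine_chartB hE PhiE.
congr (_ + _); rewrite !ffunE.
transitivity (\sum_j tnth t j * lincomb B (dh j) e).
  by apply: eq_bigr => j _; rewrite dhE !tnth_mktuple subr0.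
under eq_bigr do rewrite ffunE mulr_sumr.
rewrite exchange_big /=; apply: eq_bigr => l _; rewrite !tnth_mktuple addrC addKr.
by rewrite mulr_suml; apply: eq_bigr => j _; rewrite mulrA.
Qed.

(** Since the parameters occur among the coordinates of [Phi], it is injective and integral
    directions have integral parameters: [Phi] is a lattice chart. Whatever chart [xget] selects
    differs from it by an integral affine bijection. *)
Lemma normalized_volume_chart P d (Phi : d.-tuple R -> {ffun E -> R}) (idx : 'I_d -> E) :
  (forall e, int_affine (fun t => Phi t e)) ->
  (forall t i, Phi t (idx i) = tnth t i) ->
  range Phi = affine_hull P ->
  measurable (Phi @^-1` P : set (d.-tuple mR)) ->
  normalized_volume P = ((d`!)%:R%:E * mu d (Phi @^-1` P))%E.
Proof.
move=> aff idxE rPhi mP; rewrite /normalized_volume.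
have [p [B [Bi PhiE]]] := int_affine_chart aff.
have PhiF : Phi = affine_chart p B by exact/funext.
have Phi_inj : injective Phi.
  by move=> t u tu; apply: eq_from_tnth => i; rewrite -!idxE tu.
case: xgetP => [v _ [d' [p' [B' [ch' ->]]]]|]; last first.
  (* The default value of [xget] is excluded, because [Phi] itself provides a chart. *)
  move=> /(_ ((d`!)%:R%:E * mu d (Phi @^-1` P))%E)[].
  exists d, p, B; split; last by rewrite PhiF.
  split; [by rewrite -PhiF|by rewrite -PhiF|move=> t; split=> ti].
    by move=> e; rewrite ffunE; apply: rpred_sum => i _; rewrite rpredM.
  move=> i; have /= := ti (idx i).
  suff -> : lincomb B t (idx i) = tnth t i by [].
  have := affine_chartB p B t [tuple 0 | _ < d] (idx i).
  rewrite -!PhiE !idxE tnth_mktuple subr0 => ->; congr (lincomb B _ _).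
  by apply: eq_from_tnth => l; rewrite !tnth_mktuple subr0.
have [inj' r' _] := ch'.
(* The transition map reads the parameters of [Phi] off the point given by the selected chart; [h]
   will be its inverse. *)
pose g (t : d'.-tuple R) := [tuple affine_chart p' B' t (idx i) | i < d].
have PhiG t : Phi (g t) = affine_chart p' B' t.
  have [s _ sE] : range Phi (affine_chart p' B' t) by rewrite rPhi -r'; exists t.
  rewrite -sE; congr Phi; apply: eq_from_tnth => i.
  by rewrite tnth_mktuple -sE idxE.
have : forall t, exists s, affine_chart p' B' s = Phi t.
  move=> t; have [s _ sE] : range (affine_chart p' B') (Phi t) by rewrite r' -rPhi; exists t.
  by exists s.
move=> /choice[h hE].
have gK : cancel g h by move=> t; apply: inj'; rewrite hE PhiG.
have hK : cancel h g by move=> t; apply: Phi_inj; rewrite PhiG hE.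
have ag j : int_affine (fun t => tnth (g t) j).
  apply: int_affine_eq (int_affine_affine_chart p' _ (idx j)) => [t|].
    by rewrite tnth_mktuple.
  by move=> i e; exact: lattice_chart_int ch'.
have ah : forall j, int_affine (fun t => tnth (h t) j) := int_affine_chart_inv ch' aff hE.
have dd' := int_affine_bij_dim ag ah gK hK.
move: p' B' ch' inj' r' g PhiG h hE gK hK ag ah; rewrite dd'.
move=> p' B' ch' inj' r' g PhiG h hE gK hK ag ah; congr (_ * _)%E.
rewrite -(int_affine_bij_measure ag ah gK mP); congr (mu d _).
by apply/funext => t /=; rewrite PhiG.
Qed.

(** The line through [f0] and a point [y] of [V] contains a nonnegative point [z] near [f0], and [y]
    is the affine combination l z + (1 - l) f0. *)
Lemma affine_hull_nonneg (V : set {ffun E -> R}) (f0 : {ffun E -> R}) :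
  (forall (m : nat) (c : 'I_m -> R) (x : 'I_m -> {ffun E -> R}),
     \sum_i c i = 1 -> (forall i, V (x i)) -> V [ffun e => \sum_i c i * x i e]) ->
  V f0 -> (forall e, 0 < f0 e) ->
  affine_hull [set f : {ffun E -> R} | (forall e, 0 <= f e) /\ V f] = V.
Proof.
move=> Vaff Vf0 f0_gt0; apply/seteqP; split => [_ [m [c [x [c1 Px ->]]]]|y Vy].
  by apply: Vaff => // i; have [] := Px i.
(* Large enough that |y - f0| <= l f0 on every coordinate at once; the summand 1 keeps it
   positive. *)
pose l := 1 + \sum_e `|y e - f0 e| / f0 e.
have l0 : 0 < l.
  by apply: ltr_wpDr => //; apply: sumr_ge0 => e _; rewrite divr_ge0// ltW.
have comb2 (c : R) (f1 f2 : {ffun E -> R}) :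
    [ffun e => \sum_(i < 2) (if i == ord0 then c else 1 - c) * (if i == ord0 then f1 else f2) e]
    = [ffun e => c * f1 e + (1 - c) * f2 e].
  by apply/ffunP => e; rewrite !ffunE big_ord_recl big_ord1.
have comb1 (c : R) : \sum_(i < 2) (if i == ord0 then c else 1 - c) = 1.
  by rewrite big_ord_recl big_ord1 /= addrC subrK.
pose z : {ffun E -> R} := [ffun e => l^-1 * y e + (1 - l^-1) * f0 e].
have Vz : V z by rewrite /z -comb2; apply: Vaff => // i; case: ifP.
exists 2%N, (fun i => if i == ord0 then l else 1 - l), (fun i => if i == ord0 then z else f0).
split=> //.
  move=> i; case: ifP => _; split => // e; last exact: ltW.
  rewrite ffunE; have -> : l^-1 * y e + (1 - l^-1) * f0 e = (y e - f0 e + l * f0 e) / l.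
    by field; exact: lt0r_neq0.
  rewrite divr_ge0 ?(ltW l0)//.
  suff : `|y e - f0 e| <= l * f0 e.
    by rewrite ler_norml => /andP[+ _]; lra.
  rewrite -ler_pdivrMr// /l (bigD1 e)//= addrCA lerDl addr_ge0//.
  by apply: sumr_ge0 => e' _; rewrite divr_ge0// ltW.
rewrite comb2; apply/ffunP => e; rewrite !ffunE.
by field; exact: lt0r_neq0.
Qed.

End Charts.

(** * The cycle lemma and fundamental domains *)

Section CycleLemma.
Variables (R : realType) (m : nat).
Hypothesis m_gt0 : (0 < m)%N.
Implicit Types f : nat -> R.

Lemma sum_rotate f r :
  \sum_(0 <= i < m) f ((i + r) %% m)%N = \sum_(0 <= i < m) f i.
Proof.
case: m m_gt0 => // q _; rewrite !big_mkord.
rewrite [RHS](reindex_inj (addIr (inZp r : 'I_q.+1))) /=.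
by apply: eq_bigr => i _; rewrite modnDmr.
Qed.

(** Prefix sums of the periodic extension: those of a rotation become differences of these, with no
    wrap-around. *)
Definition cyc_sum f q := \sum_(0 <= i < q) f (i %% m)%N.

Lemma cyc_sum_rotate f p r :
  \sum_(0 <= i < p) f ((i + r) %% m)%N = cyc_sum f (p + r) - cyc_sum f r.
Proof.
rewrite /cyc_sum (big_cat_nat (leq0n r) (leq_addl p r)) /= addrAC subrr add0r.
by rewrite -{2}[r]add0n big_addn addnK.
Qed.

Lemma cyc_sumDm f q : \sum_(0 <= i < m) f i = 0 -> cyc_sum f (m + q) = cyc_sum f q.
Proof.
by move=> f0; apply/eqP; rewrite -subr_eq0 -cyc_sum_rotate sum_rotate f0.
Qed.

(** Start the rotation where the prefix sum, periodic because the total is 0, is smallest. *)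
Lemma cycle_lemma_exists f : \sum_(0 <= i < m) f i = 0 ->
  exists2 r, (r < m)%N &
    forall p, (p < m)%N -> 0 <= \sum_(0 <= i < p) f ((i + r) %% m)%N.
Proof.
move=> f0; have [r _ rmin] := arg_minP (fun i : 'I_m => cyc_sum f i)
  (isT : xpredT (Ordinal m_gt0)).
exists r => // p pm; rewrite cyc_sum_rotate subr_ge0.
have [prm|mpr] := ltnP (p + r) m; first exact: (rmin (Ordinal prm)).
have qm : (p + r - m < m)%N by have := ltn_ord r; lia.
by rewrite -(subnKC mpr) cyc_sumDm//; exact: (rmin (Ordinal qm)).
Qed.

(** If r < s, strictness makes the prefix sum at s exceed the one at r, and the one at m + r exceed
    the one at s; periodicity contradicts this. *)
Lemma cycle_lemma_unique f r s : \sum_(0 <= i < m) f i = 0 ->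
  (r < m)%N -> (s < m)%N ->
  (forall p, (0 < p < m)%N -> 0 < \sum_(0 <= i < p) f ((i + r) %% m)%N) ->
  (forall p, (0 < p < m)%N -> 0 < \sum_(0 <= i < p) f ((i + s) %% m)%N) ->
  r = s.
Proof.
move=> f0; wlog rs : r s / (r <= s)%N.
  by move=> W rm sm fr fs; case: (leqP r s) => [/W|/ltnW /W sr]; [exact|apply/esym/sr].
move=> rm sm fr fs; apply/eqP; rewrite eqn_leq rs leqNgt; apply/negP => lt_rs.
have /fr : (0 < s - r < m)%N by lia.
have /fs : (0 < m - (s - r) < m)%N by lia.
rewrite !cyc_sum_rotate subnK// (_ : (m - (s - r) + s = m + r)%N); last by lia.
by rewrite cyc_sumDm//; lra.
Qed.

End CycleLemma.

(** * Measure of a fundamental domain with a null boundary *)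

Section FundamentalDomain.
Context d (T : measurableType d) (R : realType) (mu : {measure set T -> \bar R}).

(** [D] plays the closed domain, whose translates cover [Q] and bound its measure from above; [D']
    the strict one, whose disjoint translates inside [Q] bound it from below. *)
Lemma measure_fundamental_domain (N : nat) (g : nat -> T -> T) (D D' Q : set T) :
  measurable D -> measurable D' -> measurable Q ->
  (forall q S, (q < N)%N -> measurable S ->
    measurable (g q @^-1` S) /\ mu (g q @^-1` S) = mu S) ->
  mu D = mu D' ->
  (forall t, Q t -> exists2 q, (q < N)%N & D (g q t)) ->
  (forall t q, (q < N)%N -> D' (g q t) -> Q t) ->
  (forall t q r, (q < N)%N -> (r < N)%N -> D' (g q t) -> D' (g r t) -> q = r) ->
  mu Q = (N%:R%:E * mu D)%E.
Proof.
move=> mD mD' mQ gmu DD' cov sub uniq.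
have sumE S : measurable S -> (\sum_(q < N) mu (g q @^-1` S) = N%:R%:E * mu S)%E.
  move=> mS; under eq_bigr do rewrite (gmu _ _ _ mS).2//.
  by rewrite sumr_const card_ord mule_natl.
apply/eqP; rewrite eq_le; apply/andP; split.
  rewrite -sumE//.
  have := @Boole_inequality _ _ _ mu (fun q => g q @^-1` D) N.
  move=> /(_ (fun q qN => (gmu _ _ qN mD).1)); apply: le_trans.
  apply: le_measure; rewrite ?inE//.
    by apply: bigsetU_measurable => q _; exact: (gmu _ _ _ mD).1.
  by move=> t /cov[q qN Dq]; rewrite -(bigcup_mkord N (fun q => g q @^-1` D)); exists q.
rewrite DD' -sumE// -measure_bigsetU_ord_cond.
- apply: le_measure; rewrite ?inE//.
    by apply: bigsetU_measurable => q _; exact: (gmu _ _ _ mD').1.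
  rewrite -(bigcup_mkord N (fun q => g q @^-1` D')).
  by move=> t [q /= qN Dq]; exact: sub Dq.
- by move=> q _; exact: (gmu _ _ _ mD').1.
- move=> q r _ _ [t [/= Dq Dr]]; apply/val_inj.
  exact: uniq Dq Dr.
Qed.

(** A point where [f] does not vanish leaves two cases: the zero set is a hyperplane, or [f] is a
    nonzero constant and the set is empty. *)
Lemma lebesgue_int_affine_eq0 n (f : n.-tuple R -> R) t0 :
  int_affine f -> f t0 != 0 ->
  lebesgue_tuple R n [set t : n.-tuple (measurableTypeR R) | f t = 0] = 0%E.
Proof.
move=> [c _ [e fE]] ft0.
have [[i ci]|/forallNP c0] := pselect (exists i, c i != 0).
  rewrite -[RHS](@lebesgue_tuple_hyperplane R n c e); last by exists i.
  by congr (lebesgue_tuple R n _); apply/funext => t /=; rewrite fE.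
rewrite (_ : [set _ | _] = set0) ?measure0// -subset0 => t /= ft.
have fe u : f u = e.
  rewrite fE big1 ?addr0// => i _.
  by have := c0 i; move/negP; rewrite negbK => /eqP ->; rewrite mulr0.
by move: ft0; rewrite fe -(fe t) ft eqxx.
Qed.

End FundamentalDomain.

(** * The coordinates (x, w) *)

Lemma sum_nat_shift (V : nmodType) (F : nat -> V) m p :
  \sum_(m <= i < m + p) F i = \sum_(0 <= i < p) F (m + i)%N.
Proof.
by rewrite -{1}[m]add0n big_addn addKn; apply: eq_bigr => i _; rewrite addnC.
Qed.

Lemma sum_nat_mul (V : nmodType) (F : nat -> V) k a :
  \sum_(0 <= l < k * a) F l = \sum_(0 <= i < k) \sum_(0 <= j < a) F (i * a + j)%N.
Proof.
elim: k => [|k IH]; first by rewrite mul0n !big_nil.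
rewrite big_nat_recr//= -IH mulSnr (big_cat_nat (leq0n _) (leq_addr a (k * a)))/=.
by rewrite (sum_nat_shift _ (k * a)).
Qed.

Lemma sum_nat_gt0 (R : realType) (F : nat -> R) p :
  (0 < p)%N -> (forall i, (i < p)%N -> 0 < F i) -> 0 < \sum_(0 <= i < p) F i.
Proof.
case: p => // p _ F0; rewrite big_nat_recr//= ltr_wpDl//; last exact: F0.
by rewrite big_nat_cond; apply: sumr_ge0 => i; rewrite andbT => /andP[_ ip]; exact/ltW/F0/ltnW.
Qed.

Section Coordinates.
Variables (R : realType) (k a : nat).
Hypotheses (k_gt0 : (0 < k)%N) (a_gt0 : (0 < a)%N).
Local Notation mR := (measurableTypeR R).
Local Notation n := (k + a)%N.
Local Notation b := (k * a).-1.
Local Notation d := (b + a.-1)%N.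
Local Notation mu := (lebesgue_tuple R d).
Implicit Types t : d.-tuple R.

Let bS : b.+1 = (k * a)%N. Proof. by rewrite prednK// muln_gt0 k_gt0. Qed.
Let aS : a.-1.+1 = a. Proof. exact: prednK. Qed.

Let ltn_index i j : (i < k)%N -> (j < a)%N -> (i * a + j < k * a)%N.
Proof.
move=> ik ja; rewrite (@leq_trans (i.+1 * a))// ?leq_mul2r ?ik ?orbT//.
by rewrite mulSnr ltn_add2l.
Qed.

(* The entry x_{ij} of the matrix is stored at place i * a + j; the last entry and the last
   weight are recovered from the totals k and n. *)
Definition entry t (l : nat) : R := if (l < b)%N then t`_l else k%:R - \sum_(0 <= i < b) t`_i.
Definition matrix_entry t i j := entry t (i * a + j).
Definition weight t j : R :=
  if (j < a.-1)%N then t`_(b + j) else n%:R - \sum_(b <= i < b + a.-1) t`_i.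

Lemma sum_entry t : \sum_(0 <= l < k * a) entry t l = k%:R.
Proof.
rewrite -bS big_nat_recr//= [entry t b]/entry ltnn.
rewrite (@eq_big_nat _ _ _ _ _ _ (fun i => t`_i)) => [|l /andP[_ lb]]; last by rewrite /entry lb.
by rewrite addrC subrK.
Qed.

Lemma sum_matrix_entry t : \sum_(0 <= i < k) \sum_(0 <= j < a) matrix_entry t i j = k%:R.
Proof. by rewrite -(sum_entry t) sum_nat_mul. Qed.

Lemma sum_weight t : \sum_(0 <= j < a) weight t j = n%:R.
Proof.
rewrite -{1}aS big_nat_recr//= [weight t a.-1]/weight ltnn.
rewrite (@eq_big_nat _ _ _ _ _ _ (fun i => t`_(b + i))) => [|l /andP[_ lb]]; last first.
  by rewrite /weight lb.
by rewrite (sum_nat_shift _ b) addrC subrK.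
Qed.

Lemma int_affine_entry l : int_affine (fun t => entry t l).
Proof.
rewrite /entry; case: (l < b)%N; first exact: int_affine_nth.
apply: int_affineB; first exact: int_affine_cst.
by apply: int_affine_sum => i _; exact: int_affine_nth.
Qed.

Lemma int_affine_matrix_entry i j : int_affine (fun t => matrix_entry t i j).
Proof. exact: int_affine_entry. Qed.

Lemma int_affine_weight j : int_affine (fun t => weight t j).
Proof.
rewrite /weight; case: (j < a.-1)%N; first exact: int_affine_nth.
apply: int_affineB; first exact: int_affine_cst.
by apply: int_affine_sum => i _; exact: int_affine_nth.
Qed.

Definition tuple_of_coords (X : nat -> nat -> R) (W : nat -> R) : d.-tuple R :=
  [tuple if (i < b)%N then X (i %/ a)%N (i %% a)%N else W (i - b)%N | i < d].

Lemma nth_tuple_of_coords X W l : (l < d)%N ->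
  (tuple_of_coords X W)`_l = if (l < b)%N then X (l %/ a)%N (l %% a)%N else W (l - b)%N.
Proof. by move=> ld; rewrite (nth_mktuple _ _ (Ordinal ld)). Qed.

(** The prescribed total is what lets the entry dropped by [tuple_of_coords] be recovered. *)
Lemma matrix_entry_coords X W i j : \sum_(0 <= i < k) \sum_(0 <= j < a) X i j = k%:R ->
  (i < k)%N -> (j < a)%N -> matrix_entry (tuple_of_coords X W) i j = X i j.
Proof.
move=> Xk ik ja.
pose F l := X (l %/ a)%N (l %% a)%N.
have FE i' j' : (j' < a)%N -> F (i' * a + j')%N = X i' j'.
  by move=> ja'; rewrite /F divnMDl// divn_small// addn0 modnMDl modn_small.
have Fk : \sum_(0 <= l < k * a) F l = k%:R.
  rewrite sum_nat_mul -Xk; apply: eq_bigr => i' _.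
  by apply: eq_big_nat => j' /andP[_ /FE].
have nthF l : (l < b)%N -> (tuple_of_coords X W)`_l = F l.
  by move=> lb; rewrite nth_tuple_of_coords ?lb// (leq_trans lb)// leq_addr.
rewrite -FE// /matrix_entry /entry; case: ifPn => [/nthF//|]; rewrite -leqNgt => bl.
have -> : (i * a + j)%N = b by have := ltn_index ik ja; rewrite -bS; lia.
have {}Fk : \sum_(0 <= l < b.+1) F l = k%:R by rewrite bS.
have -> : \sum_(0 <= l < b) (tuple_of_coords X W)`_l = \sum_(0 <= l < b) F l.
  by apply: eq_big_nat => l /andP[_ /nthF].
by rewrite -Fk big_nat_recr// addrAC subrr add0r.
Qed.

Lemma weight_coords X W j : \sum_(0 <= j < a) W j = n%:R -> (j < a)%N ->
  weight (tuple_of_coords X W) j = W j.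
Proof.
move=> Wn ja.
have nthW l : (l < a.-1)%N -> (tuple_of_coords X W)`_(b + l) = W l.
  by move=> la; rewrite nth_tuple_of_coords ?ltn_add2l// ltnNge leq_addr /= addKn.
rewrite /weight; case: ifPn => [/nthW//|]; rewrite -leqNgt => al.
have -> : j = a.-1 by lia.
have {}Wn : \sum_(0 <= l < a.-1.+1) W l = n%:R by rewrite aS.
have -> : \sum_(b <= l < b + a.-1) (tuple_of_coords X W)`_l = \sum_(0 <= l < a.-1) W l.
  by rewrite (sum_nat_shift _ b); apply: eq_big_nat => l /andP[_ /nthW].
by rewrite -Wn big_nat_recr// addrAC subrr add0r.
Qed.

Lemma tuple_of_coords_eta t : tuple_of_coords (matrix_entry t) (weight t) = t.
Proof.
apply: eq_from_tnth => i; rewrite !(tnth_nth 0) nth_tuple_of_coords//; case: ifPn => ib.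
  by rewrite /matrix_entry -divn_eq /entry ib.
have id := ltn_ord i.
rewrite /weight (_ : (i - b < a.-1)%N) ?subnKC//; first by rewrite leqNgt.
by move: ib id; rewrite -leqNgt; lia.
Qed.

Lemma tuple_of_coords_eq X W X' W' :
  (forall i j, (i < k)%N -> (j < a)%N -> X i j = X' i j) ->
  (forall j, (j < a)%N -> W j = W' j) -> tuple_of_coords X W = tuple_of_coords X' W'.
Proof.
move=> XX' WW'; apply: eq_from_tnth => i; rewrite !tnth_mktuple; case: ifPn => ib.
  by apply: XX'; rewrite ?ltn_mod// ltn_divLR// (leq_trans ib)// leq_pred.
by apply: WW'; have := ltn_ord i; move: ib; rewrite -leqNgt; lia.
Qed.

(** * The action of Z/k x Z/a in reduced coordinates *)

Definition rotate r s t : d.-tuple R :=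
  tuple_of_coords (fun i j => matrix_entry t ((i + r) %% k)%N ((j + s) %% a)%N)
    (fun j => weight t ((j + s) %% a)%N).

Lemma matrix_entry_rotate r s t i j : (i < k)%N -> (j < a)%N ->
  matrix_entry (rotate r s t) i j = matrix_entry t ((i + r) %% k)%N ((j + s) %% a)%N.
Proof.
move=> ik ja; rewrite matrix_entry_coords// -(sum_matrix_entry t).
rewrite (sum_rotate k_gt0 (fun i => \sum_(0 <= j < a) matrix_entry t i ((j + s) %% a)%N)).
by apply: eq_bigr => i' _; rewrite sum_rotate.
Qed.

Lemma weight_rotate r s t j : (j < a)%N -> weight (rotate r s t) j = weight t ((j + s) %% a)%N.
Proof. by move=> ja; rewrite weight_coords// sum_rotate// sum_weight. Qed.

Lemma rotateK r s r' s' : (r + r' = k)%N -> (s + s' = a)%N -> cancel (rotate r s) (rotate r' s').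
Proof.
move=> rk sa t; rewrite -[RHS]tuple_of_coords_eta; apply: tuple_of_coords_eq => [i j ik ja|j ja].
  rewrite matrix_entry_rotate ?ltn_mod// !modnDml -!addnA [(r' + r)%N]addnC [(s' + s)%N]addnC rk sa.
  by rewrite !modnDr !modn_small.
by rewrite weight_rotate ?ltn_mod// modnDml -addnA [(s' + s)%N]addnC sa modnDr modn_small.
Qed.

(** In reduced coordinates a rotation is in general no permutation, since the eliminated entry and
    weight move to stored places; they are integral affine in [t]. *)
Lemma int_affine_rotate r s i : int_affine (fun t => tnth (rotate r s t) i).
Proof.
have [ib|ib] := ltnP i b.
  apply: int_affine_eq (int_affine_matrix_entry ((i %/ a + r) %% k)%N ((i %% a + s) %% a)%N) => t.
  by rewrite tnth_mktuple ib.
apply: int_affine_eq (int_affine_weight ((i - b + s) %% a)%N) => t.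
by rewrite tnth_mktuple ltnNge ib.
Qed.

Lemma measure_rotate r s (S : set (d.-tuple mR)) : (r < k)%N -> (s < a)%N -> measurable S ->
  measurable (rotate r s @^-1` S : set (d.-tuple mR)) /\ mu (rotate r s @^-1` S) = mu S.
Proof.
move=> rk sa mS; split.
  apply: measurable_preimageT mS; apply/measurable_fun_tnthP => i.
  exact: (measurable_int_affine (int_affine_rotate r s i)).
apply: (int_affine_bij_measure (int_affine_rotate r s)
  (int_affine_rotate (k - r) (a - s)) _ mS).
by apply: rotateK; rewrite subnKC// ltnW.
Qed.

(** * Partial sums along the two paths, and the domains they cut out *)

Definition rowstep t i : R := 1 - \sum_(0 <= j < a) matrix_entry t i j.
Definition colstep t j : R := 1 + \sum_(0 <= i < k) matrix_entry t i j - weight t j.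
Definition rowsum t p := \sum_(0 <= i < p) rowstep t i.
Definition colsum t q := \sum_(0 <= j < q) colstep t j.

Lemma rowsum_total t : rowsum t k = 0.
Proof.
by rewrite /rowsum sumrB sum_matrix_entry sumr_const_nat subn0 subrr.
Qed.

Lemma colsum_total t : colsum t a = 0.
Proof.
rewrite /colsum sumrB sum_weight big_split /= exchange_big sum_matrix_entry sumr_const_nat subn0.
by rewrite natrD; ring.
Qed.

Lemma rowstep_rotate r s t i : (i < k)%N -> rowstep (rotate r s t) i = rowstep t ((i + r) %% k)%N.
Proof.
move=> ik; rewrite /rowstep -(sum_rotate a_gt0 (matrix_entry t ((i + r) %% k)) s).
congr (_ - _).
by apply: eq_big_nat => j /andP[_ ja]; rewrite matrix_entry_rotate.
Qed.

Lemma colstep_rotate r s t j : (j < a)%N -> colstep (rotate r s t) j = colstep t ((j + s) %% a)%N.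
Proof.
move=> ja; rewrite /colstep weight_rotate//.
rewrite -(sum_rotate k_gt0 (fun i => matrix_entry t i ((j + s) %% a)%N) r); congr (_ + _ - _).
by apply: eq_big_nat => i /andP[_ ik]; rewrite matrix_entry_rotate.
Qed.

Lemma rowsum_rotate r s t p : (p < k)%N ->
  rowsum (rotate r s t) p = \sum_(0 <= i < p) rowstep t ((i + r) %% k)%N.
Proof.
move=> pk; apply: eq_big_nat => i /andP[_ ip]; apply: rowstep_rotate.
exact: ltn_trans pk.
Qed.

Lemma colsum_rotate r s t q : (q < a)%N ->
  colsum (rotate r s t) q = \sum_(0 <= j < q) colstep t ((j + s) %% a)%N.
Proof.
move=> qa; apply: eq_big_nat => j /andP[_ jq]; apply: colstep_rotate.
exact: ltn_trans qa.
Qed.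

Lemma int_affine_rowsum p : int_affine (fun t => rowsum t p).
Proof.
apply: int_affine_sum => i _; apply: int_affineB; first exact: int_affine_cst.
by apply: int_affine_sum => j _; exact: int_affine_matrix_entry.
Qed.

Lemma int_affine_colsum q : int_affine (fun t => colsum t q).
Proof.
apply: int_affine_sum => j _; apply: int_affineB; last exact: int_affine_weight.
apply: int_affineD; first exact: int_affine_cst.
by apply: int_affine_sum => i _; exact: int_affine_matrix_entry.
Qed.

Definition nonneg_coords t :=
  (forall i j, (i < k)%N -> (j < a)%N -> 0 <= matrix_entry t i j) /\
  (forall j, (j < a)%N -> 0 <= weight t j).

(** Nonnegativity of the eliminated entry and of the eliminated weight gives the two upper bounds on
    sums. *)
Lemma nonneg_coordsE : nonneg_coords = @simplex_prod R b a.-1 k%:R n%:R.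
Proof.
apply/seteqP; split => t.
  move=> [x0 w0]; split; last split.
  - move=> i; rewrite -[t]tuple_of_coords_eta tnth_mktuple; case: ifPn => ib.
      by apply: x0; rewrite ?ltn_mod// ltn_divLR// (leq_trans ib)// leq_pred.
    by apply: w0; have := ltn_ord i; move: ib; rewrite -leqNgt; lia.
  - rewrite -subr_ge0.
    have -> : k%:R - \sum_(0 <= i < b) t`_i = matrix_entry t (b %/ a) (b %% a).
      by rewrite /matrix_entry -divn_eq /entry ltnn.
    by apply: x0; rewrite ?ltn_mod// ltn_divLR// bS.
  - rewrite -subr_ge0.
    have -> : n%:R - \sum_(b <= i < b + a.-1) t`_i = weight t a.-1 by rewrite /weight ltnn.
    by apply: w0; rewrite aS.
move=> [t0 [tk tn]].
have nth_ge0 i : 0 <= t`_i.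
  have [id|di] := ltnP i d; first by have := t0 (Ordinal id); rewrite (tnth_nth 0).
  by rewrite nth_default ?size_tuple.
split=> [i j _ _|j _].
  by rewrite /matrix_entry /entry; case: ifP => // _; rewrite subr_ge0.
by rewrite /weight; case: ifP => // _; rewrite subr_ge0.
Qed.

Definition flow_dom : set (d.-tuple mR) :=
  [set t | nonneg_coords t /\ (forall p : 'I_k, 0 <= rowsum t p) /\
           (forall q : 'I_a, 0 <= colsum t q)].

(** Only the partial sums are made strict, as uniqueness in the cycle lemma requires; index 0 is
    left out because the empty sum is 0. *)
Definition strict_flow_dom : set (d.-tuple mR) :=
  [set t | nonneg_coords t /\ (forall p : 'I_k, (0 < p)%N -> 0 < rowsum t p) /\
           (forall q : 'I_a, (0 < q)%N -> 0 < colsum t q)].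

Lemma measurable_nonneg_coords : measurable (nonneg_coords : set (d.-tuple mR)).
Proof. by rewrite nonneg_coordsE; exact: measurable_simplex_prod. Qed.

Lemma measurable_flow_dom : measurable flow_dom.
Proof.
apply: measurableI; first exact: measurable_nonneg_coords.
apply: measurableI; apply: measurable_forall => p; apply: measurable_int_affine_ge0.
  exact: int_affine_rowsum.
exact: int_affine_colsum.
Qed.

Lemma measurable_strict_flow_dom : measurable strict_flow_dom.
Proof.
have mimp (c : bool) (S : set (d.-tuple mR)) : measurable S -> measurable [set t | c -> S t].
  case: c => mS; first by rewrite (_ : [set t | _] = S)//; apply/seteqP; split => t /=; auto.
  by rewrite (_ : [set t | _] = setT)//; apply/seteqP; split => t.
apply: measurableI; first exact: measurable_nonneg_coords.
apply: measurableI; apply: measurable_forall => p; apply: mimp; apply: measurable_int_affine_gt0.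
  exact: int_affine_rowsum.
exact: int_affine_colsum.
Qed.

(** Up to k a copies of [eps] sum to less than 1. With all stored coordinates equal to it, the
    eliminated ones stay positive, and so do the steps away from the last row and the last
    column. *)
Let eps : R := (k * a).+1%:R^-1.

Definition center_coords : d.-tuple R := [tuple eps | _ < d].

Let eps_gt0 : 0 < eps. Proof. by rewrite invr_gt0 ltr0n. Qed.

Let eps_small m : (m <= k * a)%N -> m%:R * eps < 1.
Proof. by move=> mka; rewrite ltr_pdivrMr ?ltr0n// mul1r ltr_nat ltnS. Qed.

Let nth_center i : (i < d)%N -> center_coords`_i = eps.
Proof. by move=> id; rewrite (nth_mktuple _ _ (Ordinal id)). Qed.

Let le_b m : (m <= b)%N -> (m <= k * a)%N.
Proof. by move=> /leq_trans; apply; exact: leq_pred. Qed.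

Lemma entry_center l : (l < b)%N -> entry center_coords l = eps.
Proof. by move=> lb; rewrite /entry lb nth_center// (leq_trans lb)// leq_addr. Qed.

Lemma entry_center_gt0 l : 0 < entry center_coords l.
Proof.
have [/entry_center ->//|bl] := ltnP l b; rewrite /entry ltnNge bl /= subr_gt0.
rewrite (@eq_big_nat _ _ _ _ _ _ (fun=> eps)) => [|i /andP[_ ib]]; last first.
  by rewrite nth_center// (leq_trans ib)// leq_addr.
rewrite sumr_const_nat subn0 -[eps *+ _]mulr_natl.
by rewrite (lt_le_trans (eps_small (le_b (leqnn _))))// ler1n.
Qed.

Lemma matrix_entry_center_gt0 i j : 0 < matrix_entry center_coords i j.
Proof. exact: entry_center_gt0. Qed.

Lemma weight_center j : (j < a.-1)%N -> weight center_coords j = eps.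
Proof. by move=> ja; rewrite /weight ja nth_center// ltn_add2l. Qed.

Lemma weight_center_gt0 j : 0 < weight center_coords j.
Proof.
have [/weight_center ->//|aj] := ltnP j a.-1; rewrite /weight ltnNge aj /= subr_gt0.
rewrite (sum_nat_shift _ b) (@eq_big_nat _ _ _ _ _ _ (fun=> eps)) => [|i /andP[_ ia]].
  rewrite sumr_const_nat subn0 -[eps *+ _]mulr_natl.
  rewrite (lt_le_trans (eps_small _))//; last by rewrite ler1n addn_gt0 k_gt0.
  by rewrite (leq_trans (leq_pred a))// leq_pmull.
by rewrite nth_center// ltn_add2l.
Qed.

Lemma rowsum_center_gt0 p : (0 < p < k)%N -> 0 < rowsum center_coords p.
Proof.
move=> /andP[p0 pk]; apply: sum_nat_gt0 => // i ip; rewrite /rowstep subr_gt0.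
rewrite (@eq_big_nat _ _ _ _ _ _ (fun=> eps)) => [|j /andP[_ ja]].
  rewrite sumr_const_nat subn0 -[eps *+ _]mulr_natl; apply: eps_small; exact: leq_pmull.
rewrite /matrix_entry entry_center//.
(* As i < p < k, row [i] is not the last one, so it avoids the eliminated entry at place [b]. *)
have : (i.+1 * a <= k.-1 * a)%N by rewrite leq_mul2r; apply/orP; right; lia.
have : (k.-1 * a + a = k * a)%N by rewrite -mulSnr prednK.
rewrite mulSn; lia.
Qed.

Lemma colsum_center_gt0 q : (0 < q < a)%N -> 0 < colsum center_coords q.
Proof.
move=> /andP[q0 qa]; apply: sum_nat_gt0 => // j jq; rewrite /colstep weight_center; last by lia.
have := @eps_small 1; rewrite mul1r => /(_ _) e1.
rewrite -addrA addrCA ltr_wpDl//.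
  by apply: sumr_ge0 => i _; exact/ltW/matrix_entry_center_gt0.
by rewrite subr_gt0 e1// muln_gt0 k_gt0.
Qed.

Lemma strict_flow_dom_sub : strict_flow_dom `<=` flow_dom.
Proof.
move=> t [t0 [tr tc]]; split => //; split => [p|q].
  have [p0|p0] := posnP p; first by rewrite p0 /rowsum big_nil.
  exact/ltW/tr.
have [q0|q0] := posnP q; first by rewrite q0 /colsum big_nil.
exact/ltW/tc.
Qed.

(** The difference lies in the zero sets of finitely many partial sums, each of which is positive at
    [center_coords] and therefore has a null zero set. *)
Lemma measure_strict_flow_dom : mu flow_dom = mu strict_flow_dom.
Proof.
pose N (f : nat -> d.-tuple R -> R) m : set (d.-tuple mR) :=
  \bigcup_p (if (0 < p < m)%N then [set t | f p t = 0] else set0).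
have N0 f m : (forall p, int_affine (f p)) -> (forall p, (0 < p < m)%N -> 0 < f p center_coords) ->
    mu.-negligible (N f m).
  move=> af f0; apply: negligible_bigcup => p; case: ifPn => [pm|_]; last exact: negligible_set0.
  apply/negligibleP.
    by have := measurable_preimageT (measurable_int_affine (af p)) (measurable_set1 (0 : mR)).
  by apply: (lebesgue_int_affine_eq0 (af p)); exact/lt0r_neq0/f0.
have sub : flow_dom `\` strict_flow_dom `<=`
    N (fun p t => rowsum t p) k `|` N (fun q t => colsum t q) a.
  move=> t [[t0 [tr tc]] nt]; apply: contrapT => /not_orP[nr nc]; apply: nt.
  split => //; split => [p p0|q q0]; rewrite lt_def ?tr ?tc andbT; apply/eqP => e0.
    by apply: nr; exists p => //; rewrite p0 ltn_ord.
  by apply: nc; exists q => //; rewrite q0 ltn_ord.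
have mD := measurable_flow_dom; have mD' := measurable_strict_flow_dom.
have /negligibleP -/(_ (measurableD mD mD')) d0 : mu.-negligible (flow_dom `\` strict_flow_dom).
  apply: negligibleS sub _; apply: negligibleU; apply: N0 => p.
  - exact: int_affine_rowsum.
  - exact: rowsum_center_gt0.
  - exact: int_affine_colsum.
  - exact: colsum_center_gt0.
rewrite -(setDUK strict_flow_dom_sub) measureU//.
- by rewrite d0 adde0.
- exact: measurableD.
- by rewrite -subset0 => t [? []].
Qed.

Lemma measure_flow_dom :
  mu nonneg_coords = ((k * a)%:R%:E * mu flow_dom)%E.
Proof.
have pos_rotate r s t : nonneg_coords t -> nonneg_coords (rotate r s t).
  move=> [x0 w0]; split=> [i j ik ja|j ja].
    by rewrite matrix_entry_rotate//; apply: x0; rewrite ltn_mod.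
  by rewrite weight_rotate//; apply: w0; rewrite ltn_mod.
have divk q : (q < k * a)%N -> (q %/ a < k)%N by move=> qN; rewrite ltn_divLR.
(* An index below k a encodes the pair of rotations through its quotient and remainder modulo
   [a]. *)
apply: (@measure_fundamental_domain _ _ _ mu (k * a) (fun q => rotate (q %/ a) (q %% a))
  flow_dom strict_flow_dom).
- exact: measurable_flow_dom.
- exact: measurable_strict_flow_dom.
- exact: measurable_nonneg_coords.
- by move=> q S qN mS; apply: measure_rotate => //; [exact: divk|rewrite ltn_mod].
- exact: measure_strict_flow_dom.
- move=> t t0.
  have [r rk rP] := cycle_lemma_exists k_gt0 (rowsum_total t).
  have [s sa sP] := cycle_lemma_exists a_gt0 (colsum_total t).
  exists (r * a + s)%N; first exact: ltn_index.
  rewrite divnMDl// divn_small// addn0 modnMDl modn_small//.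
  split; first exact: pos_rotate.
  by split=> [p|q]; rewrite ?rowsum_rotate ?colsum_rotate//; [exact: rP|exact: sP].
- move=> t q qN [/(pos_rotate (k - q %/ a)%N (a - q %% a)%N) + _].
  by rewrite rotateK// subnKC// ltnW ?divk// ltn_mod.
- move=> t q q' qN q'N [_ [rq cq]] [_ [rq' cq']].
  rewrite (divn_eq q a) (divn_eq q' a); congr (_ * _ + _)%N.
    apply: (cycle_lemma_unique k_gt0 (rowsum_total t)); rewrite ?divk// => p /andP[p0 pk].
      by rewrite -(rowsum_rotate _ (q %% a))//; exact: (rq (Ordinal pk)).
    by rewrite -(rowsum_rotate _ (q' %% a))//; exact: (rq' (Ordinal pk)).
  apply: (cycle_lemma_unique a_gt0 (colsum_total t)); rewrite ?ltn_mod// => p /andP[p0 pk].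
    by rewrite -(colsum_rotate (q %/ a))//; exact: (cq (Ordinal pk)).
  by rewrite -(colsum_rotate (q' %/ a))//; exact: (cq' (Ordinal pk)).
Qed.

End Coordinates.

(** * Flows on the caracol graph *)

Lemma sum_nat_single (V : nmodType) (F : nat -> V) m m' p :
  (forall i, (m <= i < m')%N -> i != p -> F i = 0) ->
  \sum_(m <= i < m') F i = if (m <= p < m')%N then F p else 0.
Proof.
move=> F0; rewrite -(@big_nat1_eq _ _ +%R F p m m') [RHS]big_mkcond /=.
apply: eq_big_nat => i im.
by case: eqVneq => // ip; exact: F0.
Qed.

(** Turns conservation at each vertex of a path into a closed formula for the flow on its edges. *)
Lemma telescope_iff (V : zmodType) (Y F : nat -> V) m : Y 0%N = 0 ->
  (forall j, (j < m)%N -> Y j.+1 - Y j = F j) <->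
  (forall p, (p <= m)%N -> Y p = \sum_(0 <= i < p) F i).
Proof.
move=> Y0; split=> [YF p pm|YF j jm].
  rewrite -[LHS]subr0 -[X in _ - X = _]Y0 -(telescope_sumr Y (leq0n p)).
  apply: eq_big_nat => i /andP[_ ip].
  by apply: YF; exact: leq_trans pm.
by rewrite YF// (YF j (ltnW jm)) big_nat_recr//= addrAC subrr add0r.
Qed.

Section Flows.
Variables (R : realType) (k a : nat).
Hypotheses (k_gt0 : (0 < k)%N) (a_gt0 : (0 < a)%N).
Local Notation mR := (measurableTypeR R).
Local Notation n := (k + a)%N.
Local Notation b := (k * a).-1.
Local Notation d := (b + a.-1)%N.
Local Notation car := (caracol k n).
Local Notation flow := {ffun edge car -> R}.
Implicit Types (f : flow) (t : d.-tuple R).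

(** The edge relation [caracol] on zero-based natural numbers, in a form suited to linear
    arithmetic. *)
Definition adj u v : bool :=
  (u < k)%N && ((v == u.+1) || (k <= v < n)%N) ||
  (k <= u < n)%N && ((v == u.+1) || (v == n)).

Lemma adj_edge (e : edge car) : adj (src e) (tgt e).
Proof.
case: e => -[u v] /= uv; move: (uv); rewrite /caracol /adj /src /tgt /= !eqSS.
by rewrite -!andbA.
Qed.

Lemma edge_adj u v : adj u v -> exists e : edge car, src e = u :> nat /\ tgt e = v :> nat.
Proof.
move=> uv; have un : (u < n.+1)%N by move: uv; rewrite /adj; lia.
have vn : (v < n.+1)%N by move: uv; rewrite /adj; lia.
have h : car (Ordinal un) (Ordinal vn).
  by move: uv; rewrite /caracol /adj /= !eqSS -!andbA.
by exists (exist _ (Ordinal un, Ordinal vn) h).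
Qed.

(* This is 0 when (u, v) is not an edge. *)
Definition flow_at f (u v : nat) : R :=
  \sum_(e : edge car | (src e == u :> nat) && (tgt e == v :> nat)) f e.

Lemma flow_at_edge f e : flow_at f (src e) (tgt e) = f e.
Proof. by rewrite /flow_at (big_pred1 e). Qed.

Lemma flow_at_nadj f u v : ~~ adj u v -> flow_at f u v = 0.
Proof.
move=> nuv; apply: big_pred0 => e; apply: contraNF nuv => /andP[/eqP <- /eqP <-].
exact: adj_edge.
Qed.

Lemma outflowE f (j : 'I_n.+1) :
  \sum_(e | src e == j) f e = \sum_(0 <= v < n.+1) flow_at f j v.
Proof.
by rewrite big_mkord (partition_big (fun e : edge car => tgt e) xpredT).
Qed.

Lemma inflowE f (j : 'I_n.+1) :
  \sum_(e | tgt e == j) f e = \sum_(0 <= u < n.+1) flow_at f u j.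
Proof.
rewrite big_mkord (partition_big (fun e : edge car => src e) xpredT)//=.
by apply: eq_bigr => i _; apply: eq_bigl => e; rewrite andbC.
Qed.

(** Zero at both ends: nothing enters vertex 0, and the edge from k - 1 to k already counts as a
    matrix entry. Likewise [col_link] leaves that edge to the matrix and the edge from n - 1 to n to
    the weights. *)
Definition row_link f p : R := if (0 < p < k)%N then flow_at f p.-1 p else 0.
Definition col_link f q : R := if (0 < q < a)%N then flow_at f (k + q.-1) (k + q) else 0.

Lemma outflow_row f j : (j < k)%N ->
  \sum_(0 <= v < n.+1) flow_at f j v =
  row_link f j.+1 + \sum_(0 <= q < a) flow_at f j (k + q).
Proof.
move=> jk; rewrite big_nat_recr//= [flow_at f j n]flow_at_nadj; last by rewrite /adj; lia.
rewrite addr0 (big_cat_nat (leq0n k) (leq_addr a k)) /= (sum_nat_shift _ k).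
congr (_ + _); rewrite (@sum_nat_single _ _ _ _ j.+1)//= => v vk vj.
by apply: flow_at_nadj; move: vk vj; rewrite /adj; lia.
Qed.

Lemma inflow_row f j : (j < k)%N ->
  \sum_(0 <= u < n.+1) flow_at f u j = row_link f j.
Proof.
move=> jk; rewrite (@sum_nat_single _ _ _ _ j.-1) => [|u un uj]; last first.
  by apply: flow_at_nadj; move: un uj; rewrite /adj; lia.
rewrite /row_link jk andbT ifT; last by lia.
(* At j = 0 the truncated predecessor is 0 itself, and a loop is not an edge. *)
by have [->|//] := posnP j; apply: flow_at_nadj; rewrite /adj; lia.
Qed.

Lemma outflow_col f q : (q < a)%N ->
  \sum_(0 <= v < n.+1) flow_at f (k + q) v = col_link f q.+1 + flow_at f (k + q) n.
Proof.
move=> qa; rewrite big_nat_recr//=; congr (_ + _).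
rewrite (@sum_nat_single _ _ _ _ (k + q.+1)%N) => [|v vn vj].
  by rewrite /col_link ltn_add2l.
by apply: flow_at_nadj; move: vn vj; rewrite /adj; lia.
Qed.

Lemma inflow_col f q : (q < a)%N ->
  \sum_(0 <= u < n.+1) flow_at f u (k + q) =
  \sum_(0 <= i < k) flow_at f i (k + q) + col_link f q.
Proof.
move=> qa; rewrite (big_cat_nat (leq0n k) (leqW (leq_addr a k))) /=; congr (_ + _).
rewrite (@sum_nat_single _ _ _ _ (k + q.-1)%N) => [|u un uj]; last first.
  by apply: flow_at_nadj; move: un uj; rewrite /adj; lia.
rewrite /col_link qa andbT ifT; last by lia.
by have [->|//] := posnP q; apply: flow_at_nadj; rewrite /adj; lia.
Qed.

Definition conserves f := forall j : 'I_n.+1, (j < n)%N ->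
  \sum_(e : edge car | src e == j) f e - \sum_(e : edge car | tgt e == j) f e
  = unit_netflow R n ord0 j.

Definition row_balance f p :=
  \sum_(0 <= i < p) (1 - \sum_(0 <= q < a) flow_at f i (k + q)).
Definition col_balance f p :=
  \sum_(0 <= q < p) (1 + \sum_(0 <= i < k) flow_at f i (k + q) - flow_at f (k + q) n).

(** Conservation telescopes along each path. The end cases p = k and p = a, where the links are 0,
    encode the totals k and n. *)
Lemma conservesP f : conserves f <->
  (forall p, (p <= k)%N -> row_link f p = row_balance f p) /\
  (forall p, (p <= a)%N -> col_link f p = col_balance f p).
Proof.
have row0 : row_link f 0 = 0 by [].
have col0 : col_link f 0 = 0 by [].
rewrite -(telescope_iff _ k row0) -(telescope_iff _ a col0); split=> [cf|[rf cf] j jn].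
  split=> [j jk|q qa].
    have jn : (j < n.+1)%N by lia.
    have := cf (Ordinal jn); rewrite outflowE inflowE mxE /= outflow_row// inflow_row//.
    by rewrite (ltn_addr _ jk) => /(_ isT); lra.
  have jn : (k + q < n.+1)%N by lia.
  have := cf (Ordinal jn); rewrite outflowE inflowE mxE /= outflow_col// inflow_col//.
  by rewrite ltn_add2l qa => /(_ isT); lra.
rewrite outflowE inflowE mxE jn.
have [jk|kj] := ltnP j k.
  by rewrite outflow_row// inflow_row//; have := rf j jk; lra.
have qa : (j - k < a)%N by lia.
rewrite -(subnKC kj) outflow_col// inflow_col//; have := cf _ qa; lra.
Qed.

(** The order of the tests matters: the edges from k - 1 to k and from n - 1 to n look like path
    edges but carry a matrix entry and a weight. *)
Definition flow_val t (u v : nat) : R :=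
  if (u < k)%N then if (k <= v)%N then matrix_entry t u (v - k) else rowsum t u.+1
  else if v == n then weight t (u - k) else colsum t (u - k).+1.

Definition flow_of t : flow := [ffun e => flow_val t (src e) (tgt e)].

Lemma flow_at_of t u v : adj u v -> flow_at (flow_of t) u v = flow_val t u v.
Proof.
by move=> /edge_adj[e [<- <-]]; rewrite flow_at_edge ffunE.
Qed.

Lemma flow_at_of_matrix_entry t i q : (i < k)%N -> (q < a)%N ->
  flow_at (flow_of t) i (k + q) = matrix_entry t i q.
Proof.
move=> ik qa; rewrite flow_at_of ?/flow_val ?ik ?leq_addr ?addKn//.
by rewrite /adj; lia.
Qed.

Lemma flow_at_of_weight t q : (q < a)%N -> flow_at (flow_of t) (k + q) n = weight t q.
Proof.
move=> qa; rewrite flow_at_of; last by rewrite /adj; lia.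
by rewrite /flow_val ltnNge leq_addr /= eqxx addKn.
Qed.

Lemma row_balance_of t p : (p <= k)%N -> row_balance (flow_of t) p = rowsum t p.
Proof.
move=> pk; apply: eq_big_nat => i /andP[_ ip]; congr (1 - _).
by apply: eq_big_nat => q /andP[_ qa]; rewrite flow_at_of_matrix_entry// (leq_trans ip).
Qed.

Lemma col_balance_of t p : (p <= a)%N -> col_balance (flow_of t) p = colsum t p.
Proof.
move=> pa; apply: eq_big_nat => q /andP[_ qp]; have qa := leq_trans qp pa.
rewrite flow_at_of_weight//; congr (_ + _ - _).
by apply: eq_big_nat => i /andP[_ ik]; rewrite flow_at_of_matrix_entry.
Qed.

Lemma conserves_flow_of t : conserves (flow_of t).
Proof.
apply/conservesP; split=> p.
  move=> pk; rewrite row_balance_of// /row_link.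
  case: ifPn => [p0k|]; last first.
    move=> p0; have [->|->] : p = 0%N \/ p = k by lia.
      by rewrite /rowsum big_nil.
    by rewrite rowsum_total.
  rewrite flow_at_of; last by rewrite /adj; lia.
  have [p0 pk'] := andP p0k; have p1k : (p.-1 < k)%N by lia.
  by rewrite /flow_val p1k leqNgt pk' /= prednK.
move=> pa; rewrite col_balance_of// /col_link.
case: ifPn => [p0a|]; last first.
  move=> p0; have [->|->] : p = 0%N \/ p = a by lia.
    by rewrite /colsum big_nil.
  by rewrite colsum_total.
rewrite flow_at_of; last by rewrite /adj; lia.
have [p0 pa'] := andP p0a; rewrite /flow_val ltnNge leq_addr /= eqn_add2l.
by rewrite (ltn_eqF pa') addKn prednK.
Qed.

(** The matrix and the weights are read off [f]; their totals are right by the end cases of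
    [conservesP], whose other cases force the path edges. *)
Lemma conserves_flow_ofP f : conserves f -> exists t, flow_of t = f.
Proof.
move=> /conservesP[rf cf].
pose X i q := flow_at f i (k + q); pose W q := flow_at f (k + q) n.
have sumX : \sum_(0 <= i < k) \sum_(0 <= q < a) X i q = k%:R.
  have := rf k (leqnn k); rewrite /row_link ltnn andbF /row_balance sumrB sumr_const_nat subn0.
  by move/esym/subr0_eq/esym.
have sumW : \sum_(0 <= q < a) W q = n%:R.
  have := cf a (leqnn a); rewrite /col_link ltnn andbF /col_balance sumrB big_split /=.
  rewrite sumr_const_nat subn0 exchange_big /= sumX => /esym/subr0_eq/esym ->.
  by rewrite natrD addrC.
pose t : d.-tuple R := tuple_of_coords k a X W; exists t.
have xE i q : (i < k)%N -> (q < a)%N -> matrix_entry t i q = X i q by exact: matrix_entry_coords.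
have wE q : (q < a)%N -> weight t q = W q by exact: weight_coords.
have rE p : (p <= k)%N -> rowsum t p = row_balance f p.
  move=> pk; apply: eq_big_nat => i /andP[_ ip]; congr (1 - _).
  by apply: eq_big_nat => q /andP[_ qa]; rewrite xE// (leq_trans ip).
have cE p : (p <= a)%N -> colsum t p = col_balance f p.
  move=> pa; apply: eq_big_nat => q /andP[_ qp]; have qa := leq_trans qp pa.
  rewrite /colstep wE//; congr (_ + _ - _).
  by apply: eq_big_nat => i /andP[_ ik]; rewrite xE.
apply/ffunP => e; rewrite ffunE -[RHS]flow_at_edge.
move: (adj_edge e); move: (nat_of_ord (src e)) (nat_of_ord (tgt e)) => u v uv.
rewrite /flow_val; case: ifPn => uk.
  case: ifPn => kv.
    by rewrite xE /X ?subnKC//; move: uv; rewrite /adj; lia.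
  have ev : v = u.+1 by move: uv; rewrite /adj; lia.
  rewrite rE// -rf// /row_link ev /= ifT//; lia.
have ku : (k <= u)%N by lia.
case: ifPn => [/eqP ->|vn].
  by rewrite wE /W ?subnKC//; move: uv; rewrite /adj; lia.
have ev : v = u.+1 by move: uv vn; rewrite /adj; lia.
have una : ((u - k).+1 < a)%N by move: uv vn; rewrite /adj; lia.
rewrite (cE _ (ltnW una)) -(cf _ (ltnW una)) /col_link una /=.
by rewrite addnS (subnKC ku) ev.
Qed.

Lemma int_affine_flow_of e : int_affine (fun t => flow_of t e).
Proof.
apply: (@int_affine_eq _ _ (fun t => flow_val t (src e) (tgt e))) => [t|].
  by rewrite ffunE.
rewrite /flow_val; case: (_ < k)%N; first case: (k <= _)%N.
- exact: int_affine_matrix_entry.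
- exact: int_affine_rowsum.
case: (_ == n); first exact: int_affine_weight.
exact: int_affine_colsum.
Qed.

(** Every stored coordinate is the flow on some edge, as [normalized_volume_chart] demands. *)
Lemma flow_of_coords : exists idx : 'I_d -> edge car,
  forall t i, flow_of t (idx i) = tnth t i.
Proof.
have : forall i : 'I_d, exists e : edge car, forall t, flow_of t e = tnth t i.
  move=> i; have [ib|bi] := ltnP i b.
    have ik : (i %/ a < k)%N by rewrite ltn_divLR// (leq_trans ib)// leq_pred.
    have ja : (i %% a < a)%N by rewrite ltn_mod.
    have [|e [se te]] := @edge_adj (i %/ a)%N (k + i %% a)%N; first by rewrite /adj; lia.
    exists e => t; rewrite ffunE se te /flow_val ik leq_addr addKn.
    by rewrite /matrix_entry -divn_eq /entry ib (tnth_nth 0).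
  have ja : (i - b < a.-1)%N by have := ltn_ord i; lia.
  have [|e [se te]] := @edge_adj (k + (i - b))%N n; first by rewrite /adj; lia.
  exists e => t; rewrite ffunE se te /flow_val ltnNge leq_addr /= eqxx addKn.
  by rewrite /weight ja subnKC// (tnth_nth 0).
by move=> /choice[idx idxP]; exists idx => t i; exact: idxP.
Qed.

Lemma flow_of_ge0P t : (forall e, 0 <= flow_of t e) <-> @flow_dom R k a t.
Proof.
split=> [t0|[[x0 w0] [r0 c0]] e].
  have val0 u v : adj u v -> 0 <= flow_val t u v.
    by move=> /edge_adj[e [<- <-]]; have := t0 e; rewrite ffunE.
  split; split.
  - move=> i j ik ja; have := @val0 i (k + j)%N.
    by rewrite /flow_val ik leq_addr addKn; apply; rewrite /adj; lia.
  - move=> j ja; have := @val0 (k + j)%N n.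
    by rewrite /flow_val ltnNge leq_addr /= eqxx addKn; apply; rewrite /adj; lia.
  - case=> -[|p] pk /=; first by rewrite /rowsum big_nil.
    have := @val0 p p.+1; rewrite /flow_val (ltnW pk) leqNgt pk /=.
    by apply; rewrite /adj; lia.
  - case=> -[|q] qa /=; first by rewrite /colsum big_nil.
    have := @val0 (k + q)%N (k + q.+1)%N.
    rewrite /flow_val ltnNge leq_addr /= (_ : (k + q.+1 == n)%N = false); last by lia.
    by rewrite addKn; apply; rewrite /adj; lia.
rewrite ffunE; move: (adj_edge e).
move: (nat_of_ord (src e)) (nat_of_ord (tgt e)) => u v uv.
rewrite /flow_val; case: ifPn => uk.
  case: ifPn => kv; first by apply: x0 => //; move: uv; rewrite /adj; lia.
  have pk : (u.+1 < k)%N by move: uv; rewrite /adj; lia.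
  exact: (r0 (Ordinal pk)).
case: ifPn => vn; first by apply: w0; move: uv; rewrite /adj; lia.
have qa : ((u - k).+1 < a)%N by move: uv vn; rewrite /adj; lia.
exact: (c0 (Ordinal qa)).
Qed.

Lemma flow_of_center_gt0 e : 0 < flow_of (center_coords R k a) e.
Proof.
rewrite ffunE; move: (adj_edge e).
move: (nat_of_ord (src e)) (nat_of_ord (tgt e)) => u v uv.
rewrite /flow_val; case: ifPn => uk.
  case: ifPn => kv; first exact: matrix_entry_center_gt0.
  by apply: rowsum_center_gt0 => //; move: uv; rewrite /adj; lia.
case: ifPn => vn; first exact: weight_center_gt0.
by apply: colsum_center_gt0 => //; move: uv vn; rewrite /adj; lia.
Qed.

Lemma conserves_affine (m : nat) (c : 'I_m -> R) (x : 'I_m -> flow) :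
  \sum_i c i = 1 -> (forall i, conserves (x i)) ->
  conserves [ffun e => \sum_i c i * x i e].
Proof.
move=> c1 xP j jn.
have E (P : pred (edge car)) :
    \sum_(e | P e) [ffun e => \sum_i c i * x i e] e = \sum_i c i * \sum_(e | P e) x i e.
  under eq_bigr do rewrite ffunE.
  by rewrite exchange_big; apply: eq_bigr => i _; rewrite mulr_sumr.
rewrite !E -sumrB -[RHS]mul1r -c1 mulr_suml; apply: eq_bigr => i _.
by rewrite -mulrBr xP.
Qed.

Lemma range_flow_of : range flow_of =
  affine_hull (flow_polytope car (unit_netflow R n)).
Proof.
rewrite (@affine_hull_nonneg _ _ conserves (flow_of (center_coords R k a))).
- apply/seteqP; split => [_ [t _ <-]|f /conserves_flow_ofP[t <-]]; last by exists t.
  exact: conserves_flow_of.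
- exact: conserves_affine.
- exact: conserves_flow_of.
- exact: flow_of_center_gt0.
Qed.

Lemma normalized_volume_caracol :
  normalized_volume (flow_polytope car (unit_netflow R n)) =
  (d`!%:R * ((k * a)%:R^-1 * (k%:R ^+ b / b`!%:R * (n%:R ^+ a.-1 / a.-1`!%:R))))%:E.
Proof.
have [idx idxE] := flow_of_coords.
have preim : flow_of @^-1` flow_polytope car (unit_netflow R n) = @flow_dom R k a.
  apply/seteqP; split => t /=; first by move=> [/flow_of_ge0P].
  by move=> /flow_of_ge0P t0; split => //; exact: conserves_flow_of.
have mdom := @measurable_flow_dom R _ _ k_gt0 a_gt0.
rewrite (normalized_volume_chart int_affine_flow_of idxE range_flow_of); last first.
  by rewrite preim.
rewrite preim EFinM; congr (_ * _)%E.
have ka0 : (k * a)%:R != 0 :> R by rewrite pnatr_eq0 -lt0n muln_gt0 k_gt0.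
have := @measure_flow_dom R _ _ k_gt0 a_gt0.
rewrite nonneg_coordsE// lebesgue_simplex_prod ?ler0n// => E.
by rewrite EFinM E muleA -EFinM mulVf// mul1e.
Qed.

End Flows.

Unset Implicit Arguments.
Set Strict Implicit.
Set Printing Implicit Defensive.

Theorem theorem3p30 (R : realType) (k n : nat) (hk : (1 <= k)%N)
    (hn : (k < n)%N) :
  let a : nat := (n - k)%N in
  let b : nat := (k * (n - k) - 1)%N in
  normalized_volume (flow_polytope (caracol k n) (unit_netflow R n)) =
  (Cat R a b * k%:R ^ (b%:Z - 1) * n%:R ^ (a%:Z - 1))%:E.
Proof.
have [a a0 ->] : exists2 a, (0 < a)%N & n = (k + a)%N.
  by exists (n - k)%N; rewrite ?subn_gt0// subnKC// ltnW.
rewrite /= addKn normalized_volume_caracol//; congr EFin.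
rewrite subn1 /Cat; set b := (k * a).-1.
have k0 : k%:R != 0 :> R by rewrite pnatr_eq0 -lt0n.
have n0 : (k + a)%:R != 0 :> R by rewrite pnatr_eq0 -lt0n addn_gt0 hk.
(* For k = a = 1 one has b = 0 and the exponent is -1, so the power is written as a quotient. *)
have -> : k%:R ^ (b%:Z - 1) = k%:R ^+ b / k%:R :> R by rewrite expfzDr// exprN1.
have -> : (k + a)%:R ^ (a%:Z - 1) = (k + a)%:R ^+ a.-1 :> R.
  by rewrite (_ : a%:Z - 1 = a.-1)//; lia.
have fa : a`!%:R = a%:R * a.-1`!%:R :> R by rewrite -{1}(prednK a0) factS prednK// natrM.
(* This cancels the factor 1/(a + b) of [Cat] and leaves the factorial of the dimension. *)
have fab : (a + b)`!%:R = (a + b)%:R * (b + a.-1)`!%:R :> R.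
  by rewrite -natrM [(b + _)%N]addnC -{1 2}(prednK a0) addSn factS.
have binE : 'C(a + b, a)%:R = (a + b)`!%:R / (a`!%:R * b`!%:R) :> R.
  apply/(canRL (mulfK _)); first by rewrite -natrM pnatr_eq0 -lt0n muln_gt0 !fact_gt0.
  by rewrite -!natrM -[in RHS](bin_fact (leq_addr b a)) addKn.
rewrite binE fa fab natrM; field.
by rewrite -natrD !pnatr_eq0 -!lt0n !fact_gt0 hk a0 addn_gt0 a0.
Qed.
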